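(* Let $\beta_0\in(0,1)$ and let $\xi^0\in G$ be a point such that $\det \mathcal{K}(\xi^0)\neq 0$. Then there exists a number $T_0=T_0(\xi^0,\beta_0)>1$ such that for every $t_0>T_0$ the following holds. Let $\mathbf{d}=\langle d_1,\dots,d_m\rangle$ be given numbers such that the components $b_1,\dots,b_m$ of the vector $\mathcal{K}^{-1}(\xi^0)\,\mathbf{d}$ satisfy $$b_l\in R_{C,l}=\{E_{\beta}(\lambda_l(\xi^0)t_0^{\beta}) : \beta\in[\beta_0,1)\},\qquad l=1,\dots,m.$$ Then for each $l=1,\dots,m$ there exists a unique number $\beta_l^\ast\in[\beta_0,1]$ such that the Fourier transform of the solution $U=\langle u_1,\dots,u_m\rangle$ of the forward problem with vector-order $\mathcal{B}=\langle\beta_1^\ast,\dots,\beta_m^\ast\rangle$ satisfies $$\hat u_j(t_0,\xi^0)=d_j,\qquad j=1,\dots,m$$ (that is, there is exactly one vector $\langle\beta_1^\ast,\dots,\beta_m^\ast\rangle\in[\beta_0,1]^m$ for which these $m$ equalities hold).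
   Context: Spaces and operators. Let $G\subseteq\mathbb{R}^n$ be open and $p\ge1$. $\mathbf{\Psi}_{G,p}(\mathbb{R}^n)$ is the space of functions $\psi\in L_p(\mathbb{R}^n)$ whose Fourier transform $\hat\psi(\xi)=\int_{\mathbb{R}^n}\psi(x)e^{-ix\xi}\,dx$ has compact support in $G$. For a function $A(\xi)$ continuous on $G$ (possibly with arbitrary singularities on the boundary of or outside $G$), the pseudo-differential operator $A(D)$ is $A(D)\varphi(x)=\frac{1}{(2\pi)^n}\int_G A(\xi)\hat\varphi(\xi)e^{ix\xi}\,d\xi$ for $\varphi\in\mathbf{\Psi}_{G,p}(\mathbb{R}^n)$. Matrix symbol (standing assumptions). $\mathcal{A}(\xi)=(A_{j,k}(\xi))_{j,k=1}^m$ is a matrix-symbol defined and continuous on $G$, $\mathbb{A}(D)=(A_{j,k}(D))_{j,k=1}^m$. It is symmetric, $A_{k,j}(\xi)=A_{j,k}(\xi)$, and diagonalizable: there is an invertible $m\times m$ matrix function $M(\xi)$ with $\mathcal{A}(\xi)=M^{-1}(\xi)\Lambda(\xi)M(\xi)$, $\xi\in G$, where $\Lambda(\xi)=\mathrm{diag}(\lambda_1(\xi),\dots,\lambda_m(\xi))$. It is assumed that $|\arg\lambda_j(\xi)|>\frac{\pi}{2}$ for all $\xi\in G$, $j=1,\dots,m$ (principal argument; so $\mathrm{Re}\,\lambda_j(\xi)<0$). Let $\mu_{j,k}(\xi)$ denote the entries of $M^{-1}(\xi)$ and $\nu_{j,k}(\xi)$ the entries of $M(\xi)$. Caputo derivative.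 For $0<\beta<1$, $D_\ast^\beta f(t)=\frac{1}{\Gamma(1-\beta)}\int_0^t\frac{f'(\tau)\,d\tau}{(t-\tau)^{\beta}}$, and $D_\ast^1=\frac{d}{dt}$. For $\mathcal{B}=\langle\beta_1,\dots,\beta_m\rangle$, $D_\ast^{\mathcal{B}}U=\langle D_\ast^{\beta_1}u_1,\dots,D_\ast^{\beta_m}u_m\rangle$. Forward problem. For $0<\beta_j\le1$ and $\Phi=\langle\varphi_1,\dots,\varphi_m\rangle$ with $\varphi_j\in\mathbf{\Psi}_{G,p}(\mathbb{R}^n)$, the forward problem is $$D_\ast^{\mathcal{B}}U(t,x)=\mathbb{A}(D)U(t,x),\ t>0,\ x\in\mathbb{R}^n;\qquad U(0,x)=\Phi(x),\ x\in\mathbb{R}^n.$$ Its solution is $u_j(t,x)=\frac{1}{(2\pi)^n}\int_{\mathbb{R}^n}\sum_{l=1}^m E_{\beta_l}(\lambda_l(\xi)t^{\beta_l})K_{j,l}(\xi,\widehat\Phi(\xi))e^{ix\xi}\,d\xi$, with Fourier transform in $x$ $$\hat u_j(t,\xi)=\sum_{l=1}^m E_{\beta_l}(\lambda_l(\xi)t^{\beta_l})K_{j,l}(\xi,\widehat\Phi(\xi)),\qquad j=1,\dots,m,$$ regarded as defined at each point $\xi$, where $K_{j,l}(\xi,\widehat\Phi(\xi))=\mu_{j,l}(\xi)\sum_{k=1}^m\nu_{l,k}(\xi)\hat\varphi_k(\xi)$, $\widehat\Phi=\langle\hat\varphi_1,\dots,\hat\varphi_m\rangle$, and $E_\beta(z)=\sum_{k\ge0}z^k/\Gamma(\beta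 k+1)$ is the Mittag-Leffler function. Matrix $\mathcal{K}$. $\mathcal{K}(\xi^0)=\big(K_{j,l}(\xi^0,\widehat\Phi(\xi^0))\big)_{j,l=1}^m$. The numbers $d_j$, $b_l$ may be complex. *)

(* Defs.v *)
From HB Require Import structures.
From mathcomp Require Import all_boot all_order all_algebra.
From mathcomp Require Import complex.
From mathcomp Require Import all_classical all_reals all_analysis.

Set Implicit Arguments.
Unset Strict Implicit.
Unset Printing Implicit Defensive.

Import Order.TTheory GRing.Theory Num.Theory.
Import ComplexField.Normc.
Import numFieldNormedType.Exports.

Local Open Scope classical_set_scope.
Local Open Scope ring_scope.
Local Open Scope complex_scope.

(* Lebesgue measure on the Borel sets of R^d, by induction on d: the image of
   lebesgue_measure \x (Lebesgue measure on R^d) under (x, t) |-> x :: t. *)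
Section lebesgue_cons.
Context {R : realType} {d : nat}.
Local Notation mR := (measurableTypeR R).
Variable mu : {sigma_finite_measure set (d.-tuple mR) -> \bar R}.

Definition cons_pair (p : mR * d.-tuple mR) : d.+1.-tuple mR :=
  [the d.+1.-tuple mR of p.1 :: p.2].

Definition lebesgue_cons : set (d.+1.-tuple mR) -> \bar R :=
  pushforward (@lebesgue_measure R \x mu)%E cons_pair.

Let mcons : measurable_fun [set: mR * d.-tuple mR] cons_pair.
Proof. exact: measurable_cons. Qed.

Let lebesgue_cons0 : lebesgue_cons set0 = 0%E.
Proof. by rewrite /lebesgue_cons /pushforward preimage_set0 measure0. Qed.

Let lebesgue_cons_ge0 A : (0 <= lebesgue_cons A)%E.
Proof. exact: measure_ge0. Qed.

Let lebesgue_cons_sigma_additive : semi_sigma_additive lebesgue_cons.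
Proof.
move=> F mF tF mUF; rewrite /lebesgue_cons /pushforward preimage_bigcup.
have mpre A : measurable A -> measurable (cons_pair @^-1` A).
  by move=> mA; rewrite -[X in measurable X]setTI; exact: mcons.
apply: measure_semi_sigma_additive => //.
- by move=> i; exact: mpre.
- by move=> i j _ _ [x [Fi Fj]]; apply: tF => //; exists (cons_pair x).
- by rewrite -preimage_bigcup; exact: mpre.
Qed.

HB.instance Definition _ := isMeasure.Build _ _ _ lebesgue_cons
  lebesgue_cons0 lebesgue_cons_ge0 lebesgue_cons_sigma_additive.

Let lebesgue_cons_sigma_finite : sigma_finite setT lebesgue_cons.
Proof.
have /sigma_finiteP[F [FT ndF Ffin]] := sigma_finiteT (@lebesgue_measure R).
have /sigma_finiteP[H [HT ndH Hfin]] := sigma_finiteT mu.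
pose uncons (t : d.+1.-tuple mR) : mR * d.-tuple mR :=
  (thead t, [tuple of behead t]).
have muncons : measurable_fun [set: d.+1.-tuple mR] uncons.
  apply/measurable_fun_pairP; split; first exact: measurable_tnth.
  exact: measurable_behead.
have consK : uncons \o cons_pair = id.
  apply/funext => -[x t] /=; rewrite /uncons /cons_pair /=.
  by congr (_, _); exact: val_inj.
exists (fun i => uncons @^-1` (F i `*` H i)) => [|i].
  rewrite -preimage_bigcup; apply/seteqP; split => [t _ |//].
  have [k _ Fk] : (\bigcup_i F i) (uncons t).1 by rewrite -FT.
  have [l _ Hl] : (\bigcup_i H i) (uncons t).2 by rewrite -HT.
  exists (maxn k l) => //; split.
  - by move: Fk; exact/subsetPset/ndF/leq_maxl.
  - by move: Hl; exact/subsetPset/ndH/leq_maxr.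
have [mF Foo] := Ffin i; have [mH Hoo] := Hfin i.
have mFH : measurable (F i `*` H i) by exact: measurableX.
split; first by rewrite -[X in measurable X]setTI; exact: muncons.
rewrite /lebesgue_cons /pushforward -comp_preimage consK preimage_id.
by rewrite product_measure1E// lte_mul_pinfty// ge0_fin_numE.
Qed.

HB.instance Definition _ := Measure_isSigmaFinite.Build _ _ _ lebesgue_cons
  lebesgue_cons_sigma_finite.

End lebesgue_cons.

Fixpoint lebesgue_tuple (R : realType) (d : nat) :
    {sigma_finite_measure set (d.-tuple (measurableTypeR R)) -> \bar R} :=
  match d with
  | 0 => \d_([tuple of [::]] : 0.-tuple (measurableTypeR R))
  | d'.+1 => lebesgue_cons (lebesgue_tuple R d')
  end.

Section complex_integral.
Context {R : realType} {n : nat}.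
Implicit Types (f : 'rV[R]_n -> R[i]).

Definition rV_of_tuple (t : n.-tuple (measurableTypeR R)) : 'rV[R]_n :=
  \row_k tnth t k.

Definition cmeasurable f :=
  measurable_fun setT (fun t => complex.Re (f (rV_of_tuple t)) : R) /\
  measurable_fun setT (fun t => complex.Im (f (rV_of_tuple t)) : R).

Definition cintegrable f :=
  (lebesgue_tuple R n).-integrable setT
    (fun t => (complex.Re (f (rV_of_tuple t)))%:E) /\
  (lebesgue_tuple R n).-integrable setT
    (fun t => (complex.Im (f (rV_of_tuple t)))%:E).

Definition cintegral f : R[i] :=
  (\int[lebesgue_tuple R n]_t complex.Re (f (rV_of_tuple t))) +i*
  (\int[lebesgue_tuple R n]_t complex.Im (f (rV_of_tuple t))).

Definition in_Lp (p : R) f :=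
  cmeasurable f /\
  finite_norm (lebesgue_tuple R n) p%:E (fun t => normc (f (rV_of_tuple t))).

Definition dotv (x y : 'rV[R]_n) : R := \sum_k x 0 k * y 0 k.

Definition expi (s : R) : R[i] := cos s +i* sin s.

Definition fourier_integral f (xi : 'rV[R]_n) : R[i] :=
  cintegral (fun x => f x * expi (- dotv x xi)).

Definition inverse_fourier_integral f (x : 'rV[R]_n) : R[i] :=
  ((2 * pi) ^- n)%:C * cintegral (fun xi => f xi * expi (dotv x xi)).

(* Taking [vs] empty covers theta itself. *)
Definition schwartz (theta : 'rV[R]_n -> R) :=
  forall (vs : seq 'rV[R]_n) (k : nat),
    let g := foldr (fun v (h : 'rV[R]_n -> R) x => derive h x v) theta vs in
    (forall x, differentiable g x) /\
    exists C, forall x, `|x| ^+ k * `|g x| <= C.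

(* psihat is the Fourier transform of psi: the integral formula wherever that
   integral converges absolutely, and its extension to tempered distributions
   otherwise, since a psi in L_p with p > 1 need not be integrable. Real test
   functions suffice by linearity. *)
Definition is_fourier_transform (psi psihat : 'rV[R]_n -> R[i]) :=
  (cintegrable psi -> psihat =1 fourier_integral psi) /\
  (forall theta, schwartz theta ->
     cintegral (fun x => psi x * fourier_integral (fun y => (theta y)%:C) x) =
     cintegral (fun xi => psihat xi * (theta xi)%:C)).

(* psi belongs to Psi_{G,p}(R^n), with Fourier transform psihat. The transform
   is an argument because it is evaluated at single points, while for a
   nonintegrable psi it is only determined almost everywhere. *)
Definition in_Psi (G : set 'rV[R]_n) (p : R) (psi psihat : 'rV[R]_n -> R[i]) :=
  [/\ in_Lp p psi, cintegrable psihat, is_fourier_transform psi psihat,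
      compact (closure [set xi | psihat xi != 0]) &
      closure [set xi | psihat xi != 0] `<=` G].

End complex_integral.

Section mittag_leffler.
Context {R : realType}.

Definition Gamma (x : R) : R :=
  \int[lebesgue_measure]_(t in `]0, +oo[) (t `^ (x - 1) * expR (- t)).

Definition mittag_leffler (beta : R) (z : R[i]) : R[i] :=
  limn (series (fun k => z ^+ k / (Gamma (beta * k%:R + 1))%:C : R[i]^o)).

(* The principal argument, in ]-pi, pi]. At 0 the value is acos 0 = pi / 2, so
   pi / 2 < `|carg z| forces z != 0. *)
Definition carg (z : R[i]) : R :=
  let theta := acos (complex.Re z / normc z) in
  if 0 <= complex.Im z then theta else - theta.

End mittag_leffler.

Section forward_problem.
Context {R : realType} {n m : nat}.
Variables (M : 'rV[R]_n -> 'M[R[i]]_m) (lambda : 'rV[R]_n -> 'rV[R[i]]_m).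
Variable phihat : 'I_m -> 'rV[R]_n -> R[i].

Definition admissible_symbol (G : set 'rV[R]_n) (A : 'rV[R]_n -> 'M[R[i]]_m) :=
  [/\ forall j k, {within G, continuous (fun xi => A xi j k : R[i]^o)},
      forall xi, G xi -> forall j k, A xi k j = A xi j k,
      forall xi, G xi -> M xi \in unitmx,
      forall xi, G xi ->
        A xi = invmx (M xi) *m diag_mx (lambda xi) *m M xi &
      forall xi, G xi -> forall j, pi / 2 < `|carg (lambda xi 0 j)|].

(* The matrix K(xi) = (K_{j,l}(xi, phihat(xi))), with mu = M^-1, nu = M. *)
Definition Kmx (xi : 'rV[R]_n) : 'M[R[i]]_m :=
  \matrix_(j, l) (invmx (M xi) j l * \sum_k M xi l k * phihat k xi).

Definition solution_hat (B : 'rV[R]_m) (j : 'I_m) (t : R) (xi : 'rV[R]_n)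
    : R[i] :=
  \sum_l mittag_leffler (B 0 l) (lambda xi 0 l * (t `^ B 0 l)%:C) *
    Kmx xi j l.

(* The j-th component of the solution, of vector-order B, of the forward
   problem with data phi; solution_hat is its Fourier transform in x, taken at
   every point xi. *)
Definition solution (B : 'rV[R]_m) (j : 'I_m) (t : R) : 'rV[R]_n -> R[i] :=
  inverse_fourier_integral (solution_hat B j t).

End forward_problem.

(* R_{C,l} for lambda = lambda_l(xi0). *)
Definition mittag_leffler_range (R : realType) (beta0 t0 : R) (lambda : R[i])
    : set R[i] :=
  [set mittag_leffler beta (lambda * (t0 `^ beta)%:C) | beta in `[beta0, 1[].

(* Main.v *)
(* Since [K(xi0)] is invertible, the equations decouple into
   [E_b(lam_l t^b) = b_l] for each [l], so it suffices that
   [b |-> E_b(lam t^b)] is injective on [beta0, 1] for large [t] when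
   [Re lam < 0].

   Hankel's formula [1 / Gamma(a) = (1 / 2 i pi) \int exp(s) s^(-a) ds] is
   obtained as a limit of integrals over large arcs [|arg s| <= theta]. The limit
   [h(a)] satisfies [h(a) = a h(a + 1)] (integration by parts) and [h(1) = 1],
   hence [Gamma(a) h(a)] is 1-periodic on [1, +oo[; on the arc of radius [n] the
   integrands for [n + x] and [n] nearly agree, so that
   [h(n + x) n^x / h(n)] tends to 1, as does [Gamma(n + x) / (Gamma(n) n^x)], and
   [Gamma(a) h(a) = 1] follows.

   Summing a geometric series gives
   [E_b(z) = (1 / 2 i pi) \int exp(s) s^(b - 1) / (s^b - z) ds] over a contour
   whose rays lie at an angle [theta] with [pi / 2 < theta < |arg lam|]; all the
   poles stay uniformly away from it. Splitting off the leading term,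
   [- z E_b(z) = (1 - b) / Gamma(2 - b) - Q(b)] with [z = lam t^b], where
   [Q] and its Lipschitz constant in [b] are [O(t^(- beta0) (1 + ln t))]. The map
   [b |-> (1 - b) / Gamma(2 - b)] is nonnegative and decreases with slope at most
   [- 1 / 4] on [0, 1] by convexity of [Gamma], so for [t] large two different
   orders cannot give the same value. *)
Require Import Defs.
From mathcomp Require Import all_boot all_order all_algebra.
From mathcomp Require Import complex.
From mathcomp Require Import all_classical all_reals all_analysis.
From mathcomp Require Import measurable_realfun.
From mathcomp Require Import ring lra.

Set Implicit Arguments.
Unset Strict Implicit.
Unset Printing Implicit Defensive.

Import Order.TTheory GRing.Theory Num.Theory.
Import ComplexField.Normc.
Import numFieldNormedType.Exports.

Local Open Scope classical_set_scope.
Local Open Scope ring_scope.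
Local Open Scope complex_scope.
Local Notation Re := complex.Re.
Local Notation Im := complex.Im.

(** Smallness of [Q] alone cannot separate two orders that are arbitrarily close; its Lipschitz
    constant is controlled so that both sides of the final comparison carry the factor [b2 - b1]. A
    second obstacle is that [z = lam t^b] moves with the order, so equal values of [E_b(z)] do not
    give equal values of [z E_b(z)]. For [b1 < b2] and [r = t^(b1 - b2) <= 1] they give
    [h1 - Q1 = r (h2 - Q2)] with [h = (1 - b) / Gamma(2 - b)]. As [h2 >= 0], [h1 - r h2 >= h1 - h2],
    while [Q1 - r Q2 = (Q1 - Q2) + (1 - r) Q2] and [1 - r <= (b2 - b1) ln t]. Holomorphy enters only
    through derivatives along horizontal and vertical lines of the plane of [w = log s]: arcs about
    0 become vertical segments, rays become horizontal ones, and changing the radius of an arc is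
    Cauchy's theorem on a rectangle. Improper contour integrals are never formed: contours are cut
    off at radius [exp Y], with an explicit error that vanishes as [Y] grows. *)

Section complex_norm.
Context {R : realType}.
Implicit Types z w : R[i].

Lemma cReD z w : Re (z + w) = Re z + Re w. Proof. by case: z; case: w. Qed.
Lemma cImD z w : Im (z + w) = Im z + Im w. Proof. by case: z; case: w. Qed.
Lemma cReN z : Re (- z) = - Re z. Proof. by case: z. Qed.
Lemma cImN z : Im (- z) = - Im z. Proof. by case: z. Qed.
Lemma cReM z w : Re (z * w) = Re z * Re w - Im z * Im w.
Proof. by case: z; case: w. Qed.
Lemma cImM z w : Im (z * w) = Re z * Im w + Im z * Re w.
Proof. by case: z; case: w. Qed.
Lemma cReV z : Re z^-1 = Re z / (Re z ^+ 2 + Im z ^+ 2). Proof. by case: z. Qed.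
Lemma cImV z : Im z^-1 = - (Im z / (Re z ^+ 2 + Im z ^+ 2)). Proof. by case: z. Qed.

Lemma complex_ext z w : Re z = Re w -> Im z = Im w -> z = w.
Proof. by case: z => a b; case: w => c d /= -> ->. Qed.

Lemma normc_sqrtE z : normc z = Num.sqrt (Re z ^+ 2 + Im z ^+ 2).
Proof. by case: z. Qed.

Lemma normr_normc z : `|z| = (normc z)%:C. Proof. by []. Qed.

Lemma normc_ge0 z : 0 <= normc z. Proof. by rewrite normc_sqrtE sqrtr_ge0. Qed.

Lemma normc_triangle z w : normc (z + w) <= normc z + normc w.
Proof. by rewrite -lecR rmorphD /= -!normr_normc; exact: ler_normD. Qed.

Lemma normcN z : normc (- z) = normc z.
Proof. by apply: complexI; rewrite -!normr_normc normrN. Qed.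

Lemma normcB z w : normc (z - w) <= normc z + normc w.
Proof. by rewrite -(normcN w); exact: normc_triangle. Qed.

Lemma normc_distl z w : normc z - normc w <= normc (z - w).
Proof. by rewrite lerBlDr -{1}(subrK w z) normc_triangle. Qed.

Lemma normc_real (x : R) : normc x%:C = `|x|.
Proof. by rewrite /= expr0n addr0 sqrtr_sqr. Qed.

Lemma normcX z n : normc (z ^+ n) = normc z ^+ n.
Proof. by elim: n => [|n IH]; rewrite ?normc1 // !exprS normcM IH. Qed.

Lemma normc_gt0 z : (0 < normc z) = (z != 0).
Proof.
rewrite lt_neqAle normc_ge0 andbT eq_sym; congr negb.
by apply/eqP/eqP => [/eq0_normc|->]; rewrite ?normc0.
Qed.

Lemma Re_le_normc z : `|Re z| <= normc z.
Proof.
by rewrite normc_sqrtE -sqrtr_sqr ler_wsqrtr// lerDl sqr_ge0.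
Qed.

Lemma Im_le_normc z : `|Im z| <= normc z.
Proof.
by rewrite normc_sqrtE -sqrtr_sqr ler_wsqrtr// lerDr sqr_ge0.
Qed.

Lemma normc_le_ReIm z : normc z <= `|Re z| + `|Im z|.
Proof.
rewrite -[leRHS]ger0_norm ?addr_ge0// -sqrtr_sqr normc_sqrtE ler_wsqrtr//.
by rewrite sqrrD !real_normK ?num_real// lerD2r lerDl mulrn_wge0// mulr_ge0.
Qed.

Lemma sqr_normc_gt0 z : z != 0 -> Re z ^+ 2 + Im z ^+ 2 != 0.
Proof.
move=> z0; rewrite gt_eqF// lt_neqAle addr_ge0 ?sqr_ge0// andbT eq_sym.
apply: contra z0 => /eqP e; apply/eqP/eq0_normc.
by rewrite normc_sqrtE e sqrtr0.
Qed.

Lemma normc_i : normc ('i%C : R[i]) = 1.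
Proof. by rewrite /= expr0n expr1n add0r sqrtr1. Qed.

(** * The complex exponential *)

Definition cexp z : R[i] := (expR (Re z) * cos (Im z)) +i* (expR (Re z) * sin (Im z)).

Lemma cexpD z w : cexp (z + w) = cexp z * cexp w.
Proof.
by apply: complex_ext; rewrite ?cReM ?cImM /cexp /= cReD cImD expRD ?cosD ?sinD; ring.
Qed.

Lemma normc_cexp z : normc (cexp z) = expR (Re z).
Proof.
rewrite normc_sqrtE /= !exprMn -mulrDr cos2Dsin2 mulr1 sqrtr_sqr ger0_norm// expR_ge0.
Qed.

Lemma cexp0 : cexp 0 = 1.
Proof. by apply: complex_ext; rewrite /= expR0 ?cos0 ?sin0 mul1r. Qed.

Lemma cexp_neq0 z : cexp z != 0.
Proof. by rewrite -normc_gt0 normc_cexp expR_gt0. Qed.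

Lemma cexpN z : cexp (- z) = (cexp z)^-1.
Proof.
apply: (mulfI (cexp_neq0 z)); rewrite -cexpD subrr cexp0 divff//.
exact: cexp_neq0.
Qed.

Lemma cexpX z n : cexp (z *+ n) = cexp z ^+ n.
Proof.
by elim: n => [|n IH]; rewrite ?mulr0n ?cexp0// mulrS exprS cexpD IH.
Qed.

Lemma cexp_real (x : R) : cexp x%:C = (expR x)%:C.
Proof. by apply: complex_ext; rewrite /= ?cos0 ?sin0 ?mulr1 ?mulr0. Qed.

End complex_norm.

(** * Differentiation of curves in the complex plane *)

Section curve_derivative.
Context {R : realType}.
Implicit Types (f g : R -> R[i]) (d e : R[i]) (t : R).

(** Taken on real and imaginary parts, so that the real differentiation lemmas apply. The complex
    functions of interest are only ever differentiated along lines. *)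
Definition cder f d t :=
  is_derive t 1 (fun s => Re (f s)) (Re d) /\
  is_derive t 1 (fun s => Im (f s)) (Im d).

Definition cdiff f t := exists d, cder f d t.

Lemma cder_cdiff f d t : cder f d t -> cdiff f t.
Proof. by exists d. Qed.

Lemma cder_eq f d e t : cder f d t -> d = e -> cder f e t.
Proof. by move=> + <-. Qed.

Lemma cder_cst d t : cder (fun=> d) 0 t.
Proof. by split; exact: is_derive_cst. Qed.

Lemma cderD f g d e t : cder f d t -> cder g e t ->
  cder (fun s => f s + g s) (d + e) t.
Proof.
move=> [f1 f2] [g1 g2]; split; rewrite ?cReD ?cImD.
  under [X in is_derive _ _ X]funext do rewrite cReD.
  exact: is_deriveD.
under [X in is_derive _ _ X]funext do rewrite cImD.
exact: is_deriveD.
Qed.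

Lemma cderN f d t : cder f d t -> cder (fun s => - f s) (- d) t.
Proof.
move=> [f1 f2]; split; rewrite ?cReN ?cImN.
  under [X in is_derive _ _ X]funext do rewrite cReN.
  exact: is_deriveN.
under [X in is_derive _ _ X]funext do rewrite cImN.
exact: is_deriveN.
Qed.

Lemma cderB f g d e t : cder f d t -> cder g e t ->
  cder (fun s => f s - g s) (d - e) t.
Proof. by move=> df dg; apply: cderD => //; exact: cderN. Qed.

Lemma cderM f g d e t : cder f d t -> cder g e t ->
  cder (fun s => f s * g s) (d * g t + f t * e) t.
Proof.
move=> [f1 f2] [g1 g2]; split; rewrite ?cReD ?cImD ?cReM ?cImM.
  under [X in is_derive _ _ X]funext do rewrite cReM.
  apply: is_derive_eq; rewrite /GRing.scale/=; ring.
under [X in is_derive _ _ X]funext do rewrite cImM.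
apply: is_derive_eq; rewrite /GRing.scale/=; ring.
Qed.

Lemma cderV f d t : f t != 0 -> cder f d t ->
  cder (fun s => (f s)^-1) (- (d / f t ^+ 2)) t.
Proof.
move=> f0 [f1 f2].
have n0 : Re (f t) ^+ 2 + Im (f t) ^+ 2 != 0 by exact: sqr_normc_gt0.
(* The inverse of [f] is its conjugate divided by [N], the squared modulus. *)
pose N := (fun s : R => Re (f s)) ^+ 2 + (fun s : R => Im (f s)) ^+ 2.
have dN : is_derive t 1 N (2 * Re (f t) * Re d + 2 * Im (f t) * Im d).
  by apply: is_derive_eq; rewrite /GRing.scale/=; ring.
have sqr_sum_sqr (u v : R) : (u * u - v * v) ^+ 2 + (u * v + v * u) ^+ 2 = (u ^+ 2 + v ^+ 2) ^+ 2.
  by ring.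
have NE s : N s = Re (f s) ^+ 2 + Im (f s) ^+ 2 by rewrite /N !fctE.
have dVN : is_derive t 1 (fun s => (N s)^-1)
    (- (2 * Re (f t) * Re d + 2 * Im (f t) * Im d) / (Re (f t) ^+ 2 + Im (f t) ^+ 2) ^+ 2).
  have N0 : N t != 0 by rewrite NE.
  apply: (is_derive_eq (realfun.is_deriveV N0 dN)).
  by rewrite NE /GRing.scale/= mulNr mulNr mulrC.
split.
  rewrite (_ : (fun s => _) = (fun s => Re (f s)) * (fun s => (N s)^-1)); last first.
    by apply/funext => s; rewrite cReV fctE NE.
  apply: is_derive_eq; rewrite /GRing.scale/= NE cReN cReM cReV cImV.
  by rewrite expr2 cReM cImM; field; rewrite sqr_sum_sqr expf_neq0.
rewrite (_ : (fun s => _) = - ((fun s => Im (f s)) * (fun s => (N s)^-1))); last first.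
  by apply/funext => s; rewrite cImV !fctE NE.
apply: is_derive_eq; rewrite /GRing.scale/= NE cImN cImM cReV cImV.
by rewrite expr2 cReM cImM; field; rewrite sqr_sum_sqr expf_neq0.
Qed.

Lemma cder_cexp f d t : cder f d t ->
  cder (fun s => cexp (f s)) (d * cexp (f t)) t.
Proof.
move=> [f1 f2].
have e1 : is_derive t 1 (fun s => expR (Re (f s))) (expR (Re (f t)) * Re d).
  exact: (@is_derive1_comp _ expR (fun s => Re (f s))).
have c1 : is_derive t 1 (fun s => cos (Im (f s))) (- sin (Im (f t)) * Im d).
  exact: (@is_derive1_comp _ cos (fun s => Im (f s))).
have s1 : is_derive t 1 (fun s => sin (Im (f s))) (cos (Im (f t)) * Im d).
  exact: (@is_derive1_comp _ sin (fun s => Im (f s))).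
by split; rewrite ?cReM ?cImM /cexp/=; apply: is_derive_eq; rewrite /GRing.scale/=; ring.
Qed.

Lemma cder_real t : cder (fun s => s%:C) 1 t.
Proof. by split; rewrite /=; [exact: is_derive_id|exact: is_derive_cst]. Qed.

Lemma cder_hline (y t : R) : cder (fun s => s +i* y) 1 t.
Proof. by split; rewrite /=; [exact: is_derive_id|exact: is_derive_cst]. Qed.

Lemma cder_vline (x t : R) : cder (fun s => x +i* s) 'i%C t.
Proof. by split; rewrite /=; [exact: is_derive_cst|exact: is_derive_id]. Qed.

Lemma cdiff_continuous f t : cdiff f t ->
  {for t, continuous (fun s => Re (f s))} /\ {for t, continuous (fun s => Im (f s))}.
Proof.
move=> [d [[d1 _] [d2 _]]].
by split; apply: differentiable_continuous; exact/derivable1_diffP.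
Qed.

Lemma cdiffM f g t : cdiff f t -> cdiff g t -> cdiff (fun s => f s * g s) t.
Proof. by move=> [d fd] [e ge]; exact: cder_cdiff (cderM fd ge). Qed.

Lemma cdiffD f g t : cdiff f t -> cdiff g t -> cdiff (fun s => f s + g s) t.
Proof. by move=> [d fd] [e ge]; exact: cder_cdiff (cderD fd ge). Qed.

Lemma cdiffB f g t : cdiff f t -> cdiff g t -> cdiff (fun s => f s - g s) t.
Proof. by move=> [d fd] [e ge]; exact: cder_cdiff (cderB fd ge). Qed.

Lemma cdiff_cst d t : cdiff (fun=> d) t.
Proof. exact: cder_cdiff (cder_cst _ _). Qed.

Lemma cdiffV f t : f t != 0 -> cdiff f t -> cdiff (fun s => (f s)^-1) t.
Proof. by move=> f0 [d fd]; exact: cder_cdiff (cderV f0 fd). Qed.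

Lemma cdiff_cexp f t : cdiff f t -> cdiff (fun s => cexp (f s)) t.
Proof. by move=> [d fd]; exact: cder_cdiff (cder_cexp fd). Qed.

Lemma cdiff_sum n (F : 'I_n -> R -> R[i]) t : (forall i, cdiff (F i) t) ->
  cdiff (fun s => \sum_(i < n) F i s) t.
Proof.
elim: n F => [F _|n IH F dF].
  by under [X in cdiff X]funext do rewrite big_ord0; exact: cdiff_cst.
under [X in cdiff X]funext do rewrite big_ord_recr/=.
by apply: cdiffD => //; exact: IH.
Qed.

End curve_derivative.

(** * Integration of complex-valued curves over segments *)

Section curve_integral.
Context {R : realType}.
Local Notation mu := (@lebesgue_measure R).
Implicit Types (f g : R -> R[i]) (a b : R).

Definition cint a b f : R[i] :=
  (\int[mu]_(x in `[a, b]) Re (f x)) +i* (\int[mu]_(x in `[a, b]) Im (f x)).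

Lemma within_continuous_pointwise a b (h : R -> R) :
  (forall x, a <= x <= b -> {for x, continuous h}) ->
  {within `[a, b], continuous h}.
Proof.
move=> ch; apply: continuous_in_subspaceT => x; rewrite inE/= in_itv/=.
exact: ch.
Qed.

Lemma continuous_integrable a b (h : R -> R) :
  (forall x, a <= x <= b -> {for x, continuous h}) ->
  mu.-integrable `[a, b] (EFin \o h).
Proof.
move=> ch; apply: continuous_compact_integrable; first exact: segment_compact.
exact: within_continuous_pointwise.
Qed.

Lemma cdiff_integrable a b f : (forall x, a <= x <= b -> cdiff f x) ->
  mu.-integrable `[a, b] (EFin \o (fun x => Re (f x))) /\
  mu.-integrable `[a, b] (EFin \o (fun x => Im (f x))).
Proof.
by move=> df; split; apply: continuous_integrable => x /df/cdiff_continuous[].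
Qed.

Lemma eq_cint a b f g : (forall x, a <= x <= b -> f x = g x) ->
  cint a b f = cint a b g.
Proof.
move=> fg; congr (_ +i* _); apply: eq_Rintegral => x.
  by rewrite inE/= in_itv/= => /fg ->.
by rewrite inE/= in_itv/= => /fg ->.
Qed.

Lemma cintD a b f g : (forall x, a <= x <= b -> cdiff f x) ->
  (forall x, a <= x <= b -> cdiff g x) ->
  cint a b (fun x => f x + g x) = cint a b f + cint a b g.
Proof.
move=> /cdiff_integrable[f1 f2] /cdiff_integrable[g1 g2].
apply: complex_ext; [rewrite [RHS]cReD|rewrite [RHS]cImD];
  rewrite /= -RintegralD//; apply: eq_Rintegral => x _.
  by rewrite cReD.
by rewrite cImD.
Qed.

Lemma cintZ a b f (c : R[i]) : (forall x, a <= x <= b -> cdiff f x) ->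
  cint a b (fun x => c * f x) = c * cint a b f.
Proof.
move=> /cdiff_integrable[f1 f2].
have f1Z (k : R) : mu.-integrable `[a, b] (EFin \o (fun x => k * Re (f x))).
  by under [X in _.-integrable _ X]funext do rewrite /= EFinM; exact: integrableZl.
have f2Z (k : R) : mu.-integrable `[a, b] (EFin \o (fun x => k * Im (f x))).
  by under [X in _.-integrable _ X]funext do rewrite /= EFinM; exact: integrableZl.
have ZE (k : R) (h : R -> R) : mu.-integrable `[a, b] (EFin \o h) ->
    k * \int[mu]_(x in `[a, b]) h x = \int[mu]_(x in `[a, b]) (k * h x).
  by move=> ih; rewrite RintegralZl.
apply: complex_ext; [rewrite [RHS]cReM|rewrite [RHS]cImM]; rewrite /= !ZE//.
  by rewrite -RintegralB//; apply: eq_Rintegral => x _; rewrite cReM.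
by rewrite -RintegralD//; apply: eq_Rintegral => x _; rewrite cImM.
Qed.

Lemma cintB a b f g : (forall x, a <= x <= b -> cdiff f x) ->
  (forall x, a <= x <= b -> cdiff g x) ->
  cint a b (fun x => f x - g x) = cint a b f - cint a b g.
Proof.
move=> /cdiff_integrable[f1 f2] /cdiff_integrable[g1 g2].
apply: complex_ext; [rewrite [RHS]cReD cReN|rewrite [RHS]cImD cImN];
  rewrite /= -RintegralB//; apply: eq_Rintegral => x _.
  by rewrite cReD cReN.
by rewrite cImD cImN.
Qed.

Lemma cint_sum n a b (F : 'I_n -> R -> R[i]) :
  (forall i x, a <= x <= b -> cdiff (F i) x) ->
  cint a b (fun x => \sum_(i < n) F i x) = \sum_(i < n) cint a b (F i).
Proof.
elim: n F => [F _|n IH F dF].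
  rewrite big_ord0; under eq_cint do rewrite big_ord0.
  by apply: complex_ext; rewrite /= Rintegral_cst//= mul0r.
rewrite big_ord_recr/= -IH; last by move=> i x; exact: dF.
rewrite -cintD//; last 2 first.
  by move=> x xab; apply: cdiff_sum => i; exact: dF.
  by move=> x; exact: dF.
by apply: eq_cint => x _; rewrite big_ord_recr.
Qed.

(* The factor 2 comes from bounding real and imaginary parts separately. *)
Lemma normc_cint_le a b f (h : R -> R) : (forall x, a <= x <= b -> cdiff f x) ->
  mu.-integrable `[a, b] (EFin \o h) ->
  (forall x, a <= x <= b -> normc (f x) <= h x) ->
  normc (cint a b f) <= 2 * \int[mu]_(x in `[a, b]) h x.
Proof.
move=> /cdiff_integrable[f1 f2] ih fh.
rewrite (le_trans (normc_le_ReIm _))// mulr_natl mulr2n lerD//=.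
  rewrite (le_trans (le_normr_Rintegral _ _))// le_Rintegral//.
    exact: (integrable_norm f1).
  by move=> x /=; rewrite in_itv/= => /fh; apply: le_trans; exact: Re_le_normc.
rewrite (le_trans (le_normr_Rintegral _ _))// le_Rintegral//.
  exact: (integrable_norm f2).
by move=> x /=; rewrite in_itv/= => /fh; apply: le_trans; exact: Im_le_normc.
Qed.

Lemma normc_cint_le_cst a b f (k : R) : a <= b ->
  (forall x, a <= x <= b -> cdiff f x) ->
  (forall x, a <= x <= b -> normc (f x) <= k) ->
  normc (cint a b f) <= 2 * (k * (b - a)).
Proof.
move=> ab df fk.
have := @normc_cint_le a b f (cst k) df _ fk.
rewrite Rintegral_cst//= lebesgue_measure_itv/= lte_fin.
have ik : mu.-integrable `[a, b] (EFin \o cst k).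
  by apply: continuous_integrable => x _; exact: cst_continuous.
move=> /(_ ik); move: ab; rewrite le_eqVlt => /predU1P[->|->//].
by rewrite ltxx/= subrr.
Qed.

Lemma Rintegral_FTC a b (F h : R -> R) : a <= b ->
  (forall x, a <= x <= b -> is_derive x 1 F (h x)) ->
  (forall x, a <= x <= b -> {for x, continuous h}) ->
  \int[mu]_(x in `[a, b]) h x = F b - F a.
Proof.
rewrite le_eqVlt => /predU1P[<- _ _|ab dF ch].
  by rewrite set_itv1 Rintegral_set1 subrr.
have cF x : a <= x <= b -> {for x, continuous F}.
  move=> /dF[d _].
  by apply: differentiable_continuous; exact/derivable1_diffP.
have dFab : derivable_oo_LRcontinuous F a b.
  split.
  - by move=> x /=; rewrite in_itv/= => /andP[ax xb]; have [] := dF x; rewrite ?ltW.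
  - by apply: cvg_at_right_filter; apply: cF; rewrite lexx ltW.
  - by apply: cvg_at_left_filter; apply: cF; rewrite lexx ltW.
have F'h : {in `]a, b[, derive1 F =1 h}.
  move=> x; rewrite in_itv/= => /andP[ax xb]; rewrite derive1E.
  by have [] := dF x; rewrite ?ltW.
by rewrite /Rintegral (continuous_FTC2 ab (within_continuous_pointwise ch) dFab F'h).
Qed.

Lemma cint_FTC a b f g : a <= b ->
  (forall x, a <= x <= b -> cder f (g x) x) ->
  (forall x, a <= x <= b -> cdiff g x) ->
  cint a b g = f b - f a.
Proof.
move=> ab df dg; apply: complex_ext; [rewrite cReD cReN|rewrite cImD cImN]; rewrite /cint/=.
  apply: (@Rintegral_FTC a b (fun x => Re (f x)) (fun x => Re (g x))) => //.
    by move=> x /df[].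
  by move=> x /dg/cdiff_continuous[].
apply: (@Rintegral_FTC a b (fun x => Im (f x)) (fun x => Im (g x))) => //.
  by move=> x /df[].
by move=> x /dg/cdiff_continuous[].
Qed.

End curve_integral.

(** * Cauchy's theorem on rectangles *)

Section cauchy_rectangle.
Context {R : realType}.
Local Notation mu := (@lebesgue_measure R).

(** The constant [M] dominates the derivative on the bounded [y]-range, so differentiation under the
    integral sign applies on the open window of half-width 1 around [x]. *)
Lemma is_derive_Rintegral (h dh : R -> R -> R) (y1 y2 x M : R) : 0 <= M ->
  (forall s y, x - 1 < s < x + 1 -> y1 <= y <= y2 ->
     is_derive s 1 (h ^~ y) (dh s y)) ->
  (forall s y, x - 1 < s < x + 1 -> y1 <= y <= y2 -> {for y, continuous (h s)}) ->
  (forall s y, x - 1 < s < x + 1 -> y1 <= y <= y2 -> `|dh s y| <= M) ->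
  is_derive x 1 (fun s => \int[mu]_(y in `[y1, y2]) h s y)
    (\int[mu]_(y in `[y1, y2]) dh x y).
Proof.
move=> M0 dhP ch dhM.
have Ix : `]x - 1, x + 1[%classic x by rewrite /= in_itv/=; lra.
have ih s : `]x - 1, x + 1[%classic s -> mu.-integrable `[y1, y2] (EFin \o h s).
  by rewrite /= in_itv/= => xs; apply: continuous_integrable => y; exact: ch.
have dh1 s y : `]x - 1, x + 1[%classic s -> `[y1, y2]%classic y ->
    derivable (h ^~ y) s 1.
  by rewrite /= !in_itv/= => xs yy; have [] := dhP _ _ xs yy.
have p1E s y : `]x - 1, x + 1[%classic s -> `[y1, y2]%classic y ->
    partial1of2 h s y = dh s y.
  rewrite /= !in_itv/= => xs yy; rewrite partial1of2E.
  by have [] := dhP _ _ xs yy.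
have iM : mu.-integrable `[y1, y2] (EFin \o cst M).
  by apply: continuous_integrable => y _; exact: cst_continuous.
have M0' (y : R) : 0 <= cst M y by [].
have ub s y : `]x - 1, x + 1[%classic s -> `[y1, y2]%classic y ->
    `|partial1of2 h s y| <= cst M y.
  move=> xs yy; rewrite p1E//; move: xs yy; rewrite /= !in_itv/=; exact: dhM.
apply: DeriveDef.
  exact: (derivable_under_integral (mu := mu) (measurable_itv _) Ix ih dh1 M0' iM ub).
rewrite -derive1E (differentiation_under_integral (mu := mu) (measurable_itv _) Ix ih dh1 M0' iM ub).
apply: eq_Rintegral => y; rewrite inE => yy.
by rewrite p1E.
Qed.

Lemma cder_cint (g dg : R -> R -> R[i]) (y1 y2 : R) :
  (forall s y, y1 <= y <= y2 -> cder (g ^~ y) (dg s y) s) ->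
  (forall s y, y1 <= y <= y2 -> cdiff (g s) y) ->
  (forall X : R, exists M, forall s y, `|s| <= X -> y1 <= y <= y2 ->
     normc (dg s y) <= M) ->
  forall x, cder (fun s => cint y1 y2 (g s)) (cint y1 y2 (dg x)) x.
Proof.
move=> dgP cg bg x; have [M bM] := bg (`|x| + 1).
have sx s : x - 1 < s < x + 1 -> `|s| <= `|x| + 1.
  by move=> sx; rewrite -lerBlDl (le_trans (lerB_dist _ _))// ler_norml; lra.
split.
  (* When [y2 < y1] the bound is vacuous and [M] may be negative; the maximum with 0 is a legitimate
     dominating constant. *)
  apply: (@is_derive_Rintegral (fun s y => Re (g s y)) (fun s y => Re (dg s y))
    y1 y2 x (Num.max 0 M)).
  - by rewrite le_max lexx.
  - by move=> s y _ /(dgP s)[].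
  - by move=> s y _ /(cg s)/cdiff_continuous[].
  - move=> s y /sx xs /(bM _ _ xs) gM.
    by rewrite le_max (le_trans (Re_le_normc _) gM) orbT.
apply: (@is_derive_Rintegral (fun s y => Im (g s y)) (fun s y => Im (dg s y))
    y1 y2 x (Num.max 0 M)).
- by rewrite le_max lexx.
- by move=> s y _ /(dgP s)[].
- by move=> s y _ /(cg s)/cdiff_continuous[].
- move=> s y /sx xs /(bM _ _ xs) gM.
  by rewrite le_max (le_trans (Im_le_normc _) gM) orbT.
Qed.

(** The integral over the vertical segment at abscissa [x] has derivative the integral of [dg],
    which the vertical derivative of [g] turns into [- i] times the difference of [g] at the two
    ends; integrating in [x] gives the formula. The two derivative hypotheses are the Cauchy-Riemann
    equations in directional form. *)
Lemma cauchy_rectangle (g dg : R[i] -> R[i]) (y1 y2 x1 x2 : R) :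
  y1 <= y2 -> x1 <= x2 ->
  (forall x y, y1 <= y <= y2 -> cder (fun s => g (s +i* y)) (dg (x +i* y)) x) ->
  (forall x y, y1 <= y <= y2 -> cder (fun s => g (x +i* s)) ('i%C * dg (x +i* y)) y) ->
  (forall x y, y1 <= y <= y2 -> cdiff (fun s => dg (x +i* s)) y) ->
  (forall X : R, exists M, forall x y, `|x| <= X -> y1 <= y <= y2 ->
     normc (dg (x +i* y)) <= M) ->
  cint y1 y2 (fun y => g (x2 +i* y)) - cint y1 y2 (fun y => g (x1 +i* y)) =
  - 'i%C * cint x1 x2 (fun x => g (x +i* y2) - g (x +i* y1)).
Proof.
move=> y12 x12 dgx dgy ddg bg.
have diffy x y : y1 <= y <= y2 -> cdiff (fun s => g (x +i* s)) y.
  by move=> yy; exact: cder_cdiff (dgy _ _ yy).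
have iE x : cint y1 y2 (fun y => dg (x +i* y)) =
    - 'i%C * (g (x +i* y2) - g (x +i* y1)).
  rewrite -(@cint_FTC _ y1 y2 (fun y => g (x +i* y)) (fun y => 'i%C * dg (x +i* y)))//.
  - rewrite cintZ; last by move=> y; exact: ddg.
    by rewrite mulrA mulNr -expr2 sqr_i opprK mul1r.
  - by move=> y; exact: dgy.
  - by move=> y yy; apply: cdiffM; [exact: cdiff_cst|exact: ddg].
have y1i : y1 <= y1 <= y2 by rewrite lexx.
have y2i : y1 <= y2 <= y2 by rewrite lexx andbT.
have diffx x : cdiff (fun x => g (x +i* y2) - g (x +i* y1)) x.
  by apply: cdiffB; [exact: cder_cdiff (dgx _ _ y2i)|exact: cder_cdiff (dgx _ _ y1i)].
have key x := @cder_cint (fun x y => g (x +i* y)) (fun x y => dg (x +i* y))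
  y1 y2 dgx diffy bg x.
rewrite -cintZ//.
rewrite -(@cint_FTC _ x1 x2 (fun x => cint y1 y2 (fun y => g (x +i* y)))
  (fun x => - 'i%C * (g (x +i* y2) - g (x +i* y1))))//.
- by move=> x _; rewrite -iE.
- by move=> x _; apply: cdiffM => //; exact: cdiff_cst.
Qed.

End cauchy_rectangle.

(** * Integrands in the logarithmic coordinate *)

Section hankel_kernel.
Context {R : realType}.
Implicit Types (c b x y : R) (z w : R[i]).

(* The Hankel-type integrands in the coordinate [w = log s], in which every
   power of [s] is an exponential and no branch has to be chosen. *)
Definition wkernel c b z w : R[i] :=
  cexp (cexp w + c%:C * w) / (cexp (b%:C * w) - z).

(** The derivative of [wkernel], factored through its logarithmic derivative so that bounds on
    [wkernel] carry over. *)
Definition wkernel' c b z w : R[i] := wkernel c b z w *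
  (cexp w + c%:C - b%:C * cexp (b%:C * w) / (cexp (b%:C * w) - z)).

(** Parametrised by the angle, without the factor [i] of [dw = i dy]: contour integrals normalised
    by [1 / (2 i pi)] become [arcint] divided by [2 pi]. *)
Definition arcint (theta Y : R) (g : R[i] -> R[i]) : R[i] :=
  cint (- theta) theta (fun y => g (Y +i* y)).

Lemma cder_wkernel c b z (f : R -> R[i]) d t :
  cexp (b%:C * f t) - z != 0 -> cder f d t ->
  cder (fun s => wkernel c b z (f s)) (d * wkernel' c b z (f t)) t.
Proof.
move=> n0 df; rewrite /wkernel.
have dM (k : R) : cder (fun s => k%:C * f s) (0 * f t + k%:C * d) t.
  exact: cderM (cder_cst _ _) df.
have d1 := cder_cexp (cderD (cder_cexp df) (dM c)).
have d2 := cderB (cder_cexp (dM b)) (cder_cst z t).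
apply: (cder_eq (cderM d1 (cderV n0 d2))).
by rewrite /wkernel' /wkernel; field.
Qed.

Lemma cdiff_wkernel' c b z (f : R -> R[i]) t :
  cexp (b%:C * f t) - z != 0 -> cdiff f t ->
  cdiff (fun s => wkernel' c b z (f s)) t.
Proof.
move=> n0 df; have [d fd] := df.
have db : cdiff (fun s => cexp (b%:C * f s)) t.
  by apply: cdiff_cexp; apply: cdiffM => //; exact: cdiff_cst.
rewrite /wkernel'; apply: cdiffM; first exact: cder_cdiff (cder_wkernel c n0 fd).
apply: cdiffB.
  by apply: cdiffD; [exact: cdiff_cexp|exact: cdiff_cst].
apply: cdiffM; first by apply: cdiffM => //; exact: cdiff_cst.
by apply: cdiffV => //; apply: cdiffB => //; exact: cdiff_cst.
Qed.

Lemma normc_wkernel c b z x y delta : 0 < delta ->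
  delta <= normc (cexp (b%:C * (x +i* y)) - z) ->
  normc (wkernel c b z (x +i* y)) <= expR (expR x * cos y + c * x) / delta.
Proof.
move=> d0 dle; rewrite /wkernel normcM normcV normc_cexp /=.
rewrite mul0r subr0 ler_pM ?expR_ge0 ?invr_ge0 ?normc_ge0//.
by rewrite lef_pV2// posrE (lt_le_trans d0).
Qed.

(** Moving an arc from one radius to another costs the integrals along the two rays in between. The
    lower bound [delta] keeps the poles off the strip and provides the bound on the derivative that
    [cauchy_rectangle] asks for. *)
Lemma wkernel_shift c b z theta delta x1 x2 : 0 < delta -> 0 <= theta ->
  (forall x y, - theta <= y <= theta ->
     delta <= normc (cexp (b%:C * (x +i* y)) - z)) ->
  x1 <= x2 ->
  arcint theta x2 (wkernel c b z) - arcint theta x1 (wkernel c b z) =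
  - 'i%C * cint x1 x2 (fun x => wkernel c b z (x +i* theta) -
                             wkernel c b z (x +i* (- theta))).
Proof.
move=> d0 t0 dle x12.
have n0 x y : - theta <= y <= theta -> cexp (b%:C * (x +i* y)) - z != 0.
  by move=> /(dle x) ?; rewrite -normc_gt0 (lt_le_trans d0).
apply: (cauchy_rectangle (dg := wkernel' c b z)) => //.
- by rewrite ge0_cp.
- move=> x y yt; apply: (cder_eq (cder_wkernel c (n0 x y yt) (cder_hline y x))).
  by rewrite mul1r.
- by move=> x y yt; exact: (cder_wkernel c (n0 x y yt) (cder_vline x y)).
- move=> x y yt; apply: cdiff_wkernel'; first exact: n0.
  exact: cder_cdiff (cder_vline x y).
move=> X; exists (expR (expR X + `|c| * X) / delta *
  (expR X + `|c| + `|b| * expR (`|b| * X) / delta)) => x y xX yt.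
have xX' : x <= X by rewrite (le_trans (ler_norm _)).
have kx k : k * x <= `|k| * X.
  by rewrite (le_trans (ler_norm _))// normrM ler_wpM2l.
rewrite /wkernel' normcM ler_pM ?normc_ge0//.
  rewrite (le_trans (normc_wkernel _ d0 (dle x y yt)))// ler_wpM2r ?invr_ge0 ?(ltW d0)//.
  rewrite ler_expR lerD// (@le_trans _ _ (expR x))//.
    by rewrite ler_piMr ?expR_ge0// cos_le1.
  by rewrite ler_expR.
rewrite (le_trans (normcB _ _))// lerD//.
  rewrite (le_trans (normc_triangle _ _))// normc_real lerD//.
  by rewrite normc_cexp/= ler_expR.
rewrite !normcM normcV normc_real normc_cexp /= mul0r subr0.
rewrite ler_pM ?mulr_ge0 ?expR_ge0 ?invr_ge0 ?normc_ge0//.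
  by rewrite ler_wpM2l// ler_expR.
by rewrite lef_pV2 ?posrE ?(lt_le_trans d0 (dle x y yt))// dle.
Qed.

End hankel_kernel.

(** * Euler's integral: domination and the value at 1 *)

Section gamma_function.
Context {R : realType}.
Local Notation mu := (@lebesgue_measure R).
Local Notation Rpos := (`]0, +oo[%classic : set R).
Implicit Types (x y s t : R).

Definition gamma_integrand x t : R := t `^ (x - 1) * expR (- t).

Lemma gt0_powRE t x : 0 < t -> t `^ x = expR (x * ln t).
Proof. by move=> t0; rewrite /powR gt_eqF. Qed.

Lemma ln_le_subr1 t : 0 < t -> ln t <= t - 1.
Proof.
by move=> t0; rewrite -[X in ln X](subrKC 1); apply: le_ln1Dx; lra.
Qed.

Lemma ln_le_scaled t c : 0 < c -> 0 < t -> ln t <= ln c + t / c - 1.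
Proof.
move=> c0 t0; have := ln_le_subr1 (divr_gt0 t0 c0).
by rewrite ln_div ?posrE//; lra.
Qed.

(** Both exponentials lie above the tangent at the barycentre [z], and the linear terms cancel in
    the weighted sum. *)
Lemma expR_convex_comb s x y : 0 <= s <= 1 ->
  expR (s * x + (1 - s) * y) <= s * expR x + (1 - s) * expR y.
Proof.
move=> /andP[s0 s1]; set z := s * x + (1 - s) * y.
have ex := expR_ge1Dx (x - z); have ey := expR_ge1Dx (y - z).
have -> : s * expR x + (1 - s) * expR y =
    (s * expR (x - z) + (1 - s) * expR (y - z)) * expR z.
  by rewrite [RHS]mulrDl -!mulrA -!expRD !subrK.
rewrite ler_peMl ?expR_ge0//.
rewrite (@le_trans _ _ (s * (1 + (x - z)) + (1 - s) * (1 + (y - z))))//.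
  by rewrite /z; lra.
by rewrite lerD// ler_wpM2l// subr_ge0.
Qed.

Lemma gamma_integrand_ge0 x t : 0 <= gamma_integrand x t.
Proof. by rewrite mulr_ge0 ?powR_ge0 ?expR_ge0. Qed.

Lemma measurable_gamma_integrand x : measurable_fun setT (gamma_integrand x).
Proof.
apply: measurable_funM.
  exact: measurable_powR.
by apply: measurableT_comp => //; exact: measurable_funN.
Qed.

(** The logarithm lies below its tangent at [2 x], of slope [1 / (2 x)]; multiplied by [x - 1] this
    costs at most [t / 2], half of the available decay. *)
Lemma gamma_integrand_le x t : 1 <= x -> 0 < t ->
  gamma_integrand x t <= expR (x * `|ln (2 * x)|) * expR (- (t / 2)).
Proof.
move=> x1 t0; rewrite /gamma_integrand gt0_powRE// -!expRD ler_expR.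
have c0 : 0 < 2 * x by lra.
have lnle := ln_le_scaled c0 t0.
have qE : x * (t / (2 * x)) = t / 2 by field; lra.
have q0 : 0 <= t / (2 * x) by rewrite divr_ge0 ?ltW.
set q := t / (2 * x) in lnle qE q0.
have h1 : (x - 1) * ln t <= (x - 1) * (ln (2 * x) + q - 1).
  by rewrite ler_wpM2l// subr_ge0.
have h2 : (x - 1) * ln (2 * x) <= x * `|ln (2 * x)|.
  by rewrite (le_trans (ler_norm _))// normrM ler_wpM2r// ger0_norm; lra.
by lra.
Qed.

Lemma integrable_gamma x : 1 <= x ->
  mu.-integrable Rpos (EFin \o gamma_integrand x).
Proof.
move=> x1; set C := expR (x * `|ln (2 * x)|).
(* The exponential density of rate 1/2 carries a factor 1/2, which the 2 cancels. *)
have h : mu.-integrable Rpos (fun t => (C * 2)%:E * (EFin \o @exponential_pdf R 2^-1) t)%E.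
  apply: integrableZl => //; apply: (@integrableS _ _ _ mu setT) => //.
  by apply: integrable_exponential_pdf; rewrite ?invr_ge0 ?invr_gt0.
apply: le_integrable h => //.
  by apply/measurable_EFinP; apply: measurable_funTS; exact: measurable_gamma_integrand.
move=> t /=; rewrite in_itv/= andbT => t0.
rewrite lee_fin !ger0_norm ?gamma_integrand_ge0//; last first.
  by rewrite !mulr_ge0 ?expR_ge0// exponential_pdf_ge0 ?invr_ge0.
rewrite (le_trans (gamma_integrand_le x1 t0))// -mulrA ler_wpM2l ?expR_ge0//.
rewrite /exponential_pdf patchE ifT; last by rewrite inE/= in_itv/= andbT ltW.
by rewrite mulrA divff// mul1r mulNr mulrC.
Qed.

Lemma Gamma1 : Gamma 1 = 1 :> R.
Proof.
rewrite /Gamma.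
have -> : \int[mu]_(t in Rpos) (t `^ (1 - 1) * expR (- t)) =
    \int[mu]_(t in Rpos) exponential_pdf 1 t.
  apply: eq_Rintegral => t; rewrite inE/= in_itv/= andbT => t0.
  rewrite subrr powRr0 mul1r /exponential_pdf patchE ifT ?mul1r ?mulN1r//.
  by rewrite inE/= in_itv/= andbT ltW.
rewrite Rintegral_itv_obnd_cbnd; last first.
  apply: (@integrableS _ _ _ mu setT) => //.
  exact: integrable_exponential_pdf.
rewrite (_ : Rintegral _ _ _ = Rintegral mu setT (exponential_pdf 1)).
  by rewrite /Rintegral integral_exponential_pdf.
rewrite [RHS]Rintegral_mkcond Rintegral_mkcond; congr Rintegral.
by rewrite patch_setT /exponential_pdf -patch_setI setIid.
Qed.

End gamma_function.

(** * The functional equation of Gamma *)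

Section gamma_properties.
Context {R : realType}.
Local Notation mu := (@lebesgue_measure R).
Local Notation Rpos := (`]0, +oo[%classic : set R).
Implicit Types (x y s t : R).

Lemma cvg_powR_expRN x : 1 <= x ->
  (fun t : R => t `^ x * expR (- t)) @ +oo --> (0 : R).
Proof.
move=> x1.
have x2 : 1 <= x + 1 by lra.
set K := expR ((x + 1) * `|ln (2 * (x + 1))|).
have cK : (fun t : R => K * expR (- (t / 2))) @ +oo --> (0 : R).
  rewrite -[X in _ --> X](mulr0 K); apply: cvgM; first exact: cvg_cst.
  apply: (@cvg_comp _ _ _ _ (fun u : R => expR (- u)) _ (pinfty_nbhs R));
    last exact: cvgr_expR.
  by apply: gt0_cvgMly; [rewrite invr_gt0|exact: cvg_id].
apply: (@squeeze_cvgr _ _ _ _ (cst 0) (fun t : R => K * expR (- (t / 2)))) => //.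
- near=> t.
  rewrite /= mulr_ge0 ?powR_ge0 ?expR_ge0//=.
  have t0 : 0 < t by near: t; exact: nbhs_pinfty_gt.
  by have := gamma_integrand_le x2 t0; rewrite /gamma_integrand addrK.
- exact: cvg_cst.
Unshelve. all: by end_near. Qed.

Lemma GammaE x : Gamma x = \int[mu]_(t in Rpos) gamma_integrand x t :> R.
Proof. by []. Qed.

(** Integration by parts: [f] is the derivative of [F], which vanishes at 0 and at infinity. By
    [fE], [f] changes sign at [t = x]; the integral is split there, so that the fundamental theorem
    on the half-line is applied to a nonnegative function. *)
Lemma GammaS x : 1 <= x -> Gamma (x + 1) = x * Gamma x :> R.
Proof.
move=> x1; have x0 : 0 < x by lra.
pose f t : R := gamma_integrand (x + 1) t - x * gamma_integrand x t.
pose F t : R := - (t `^ x * expR (- t)).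
have i1 := integrable_gamma x1.
have i2 : mu.-integrable Rpos (EFin \o gamma_integrand (x + 1)).
  by apply: integrable_gamma; lra.
have i3 : mu.-integrable Rpos (EFin \o (fun t => x * gamma_integrand x t)).
  by under [X in _.-integrable _ X]funext do rewrite /= EFinM; exact: integrableZl.
have ifP : mu.-integrable Rpos (EFin \o f).
  by under [X in _.-integrable _ X]funext do rewrite /= EFinB; exact: integrableB.
have fE t : 0 < t -> f t = (t - x) * gamma_integrand x t.
  move=> t0; rewrite /f /gamma_integrand addrK.
  by rewrite -(mulr_powRB1 (ltW t0) x0); ring.
have dF t : 0 < t -> is_derive t 1 F (f t).
  move=> t0; rewrite /F.
  have d1 : is_derive t 1 (fun t : R => t `^ x) (x * t `^ (x - 1)).
    exact: is_derive1_powR.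
  have d2 : is_derive t 1 (fun t : R => expR (- t)) (expR (- t) * - 1).
    exact: (@is_derive1_comp _ expR -%R).
  apply: is_derive_eq; rewrite /GRing.scale/= /f /gamma_integrand addrK.
  by ring.
have cf t : 0 < t -> {for t, continuous f}.
  move=> t0.
  have cpow k : {for t, continuous (fun t : R => t `^ k)}.
    apply: differentiable_continuous; apply/derivable1_diffP.
    by apply: derivable_powR; rewrite in_itv/= t0.
  have cexp' : {for t, continuous (fun t : R => expR (- t))}.
    by apply: continuous_comp; [exact: opp_continuous|exact: continuous_expR].
  apply: continuousB; first by apply: continuousM => //; exact: cpow.
  apply: continuousM; first exact: cst_continuous.
  by apply: continuousM => //; exact: cpow.
(* The exponent 0 occurs for [x = 1]; the convention that the power of 0 with exponent 0 is 1 agrees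
   with the limit from the right. *)
have cpow0 k : 0 <= k -> (fun t : R => t `^ k) @ 0^'+ --> (0 : R) `^ k.
  rewrite le_eqVlt => /predU1P[<-|k0].
    by under eq_fun do rewrite powRr0; rewrite powRr0; exact: cvg_cst.
  by rewrite powR0 ?gt_eqF//; exact: powR_cvg0.
have cexp0 : (fun t : R => expR (- t)) @ 0^'+ --> expR (- 0 : R).
  apply: cvg_at_right_filter.
  by apply: continuous_comp; [exact: opp_continuous|exact: continuous_expR].
have f0 : f @ 0^'+ --> f 0.
  apply: cvgB.
    by apply: cvgM => //; apply: cpow0; rewrite addrK; lra.
  apply: cvgM; first exact: cvg_cst.
  by apply: cvgM => //; apply: cpow0; lra.
have F0 : F @ 0^'+ --> F 0.
  by apply: cvgN; apply: cvgM => //; apply: cpow0; lra.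
have derF t : 0 < t -> derivable F t 1 by move=> /dF[].
have cF t : 0 < t -> {for t, continuous F}.
  move=> /derF dFt; apply: differentiable_continuous; exact/derivable1_diffP.
have F'f t : 0 < t -> derive1 F t = f t.
  by move=> t0; rewrite derive1E; have [] := dF _ t0.
have I1 : \int[mu]_(t in `[0, x]) f t = F x - F 0.
  rewrite /Rintegral (@continuous_FTC2 _ f F)//.
  - apply/continuous_within_itvP => //; split => //.
      by move=> t; rewrite in_itv/= => /andP[t0 _]; exact: cf.
    by apply: cvg_at_left_filter; exact: cf.
  - split => //.
      by move=> t; rewrite in_itv/= => /andP[t0 _]; exact: derF.
    by apply: cvg_at_left_filter; exact: cF.
  - by move=> t; rewrite in_itv/= => /andP[t0 _]; exact: F'f.
have I2 : \int[mu]_(t in `[x, +oo[) f t = 0 - F x.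
  apply: (@Rintegral_ge0_continuous_FTC2y _ f F).
  - move=> t xt; rewrite fE ?(lt_le_trans x0)// mulr_ge0 ?gamma_integrand_ge0//.
    by rewrite subr_ge0.
  - apply/continuous_within_itvcyP; split.
      by move=> t; rewrite in_itv/= andbT => xt; apply: cf; exact: lt_trans xt.
    by apply: cvg_at_right_filter; exact: cf.
  - by rewrite -oppr0; apply: cvgN; exact: cvg_powR_expRN.
  - by move=> t xt; apply: derF; exact: lt_trans xt.
  - by apply: cvg_at_right_filter; exact: cF.
  - by move=> t; rewrite in_itv/= andbT => xt; apply: F'f; exact: lt_trans xt.
have intf0 : \int[mu]_(t in Rpos) f t = 0.
  have := @Rintegral_itvB R f (BRight 0) +oo%O x ifP.
  rewrite bnd_simp (ltW x0) => /(_ isT isT).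
  have ifl : mu.-integrable `]0, x] (EFin \o f).
    by apply: integrableS ifP => //; exact: subset_itvl.
  have ifr : mu.-integrable `]x, +oo[ (EFin \o f).
    by apply: integrableS ifP => //; apply: subset_itvr; rewrite bnd_simp ltW.
  rewrite (Rintegral_itv_obnd_cbnd ifl) (Rintegral_itv_obnd_cbnd ifr) I1 I2 => /eqP; rewrite subr_eq => /eqP ->.
  by rewrite /F powR0 ?gt_eqF// mul0r oppr0 subr0 sub0r addNr.
have If0 : Gamma (x + 1) - x * Gamma x = 0 :> R.
  by rewrite -[RHS]intf0 !GammaE /f RintegralB// RintegralZl.
by apply/eqP; rewrite -subr_eq0 If0.
Qed.

End gamma_properties.

(** * Convexity of Gamma and the slope of its inverse *)

Section gamma_inequalities.
Context {R : realType}.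
Local Notation mu := (@lebesgue_measure R).
Implicit Types (x y s t : R).

Lemma Gamma_le_comb x y1 y2 a1 a2 : 1 <= x -> 1 <= y1 -> 1 <= y2 ->
  (forall t, 0 < t -> t `^ (x - 1) <= a1 * t `^ (y1 - 1) + a2 * t `^ (y2 - 1)) ->
  Gamma x <= a1 * Gamma y1 + a2 * Gamma y2 :> R.
Proof.
move=> x1 y11 y21 le; rewrite !GammaE.
have iZ a z : 1 <= z ->
    mu.-integrable `]0, +oo[ (EFin \o (fun t => a * gamma_integrand z t)).
  move=> z1; under [X in _.-integrable _ X]funext do rewrite /= EFinM.
  by apply: integrableZl => //; exact: integrable_gamma.
rewrite -(RintegralZl a1 _ (integrable_gamma y11))//.
rewrite -(RintegralZl a2 _ (integrable_gamma y21))//.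
rewrite -RintegralD//; [|exact: iZ..].
apply: le_Rintegral => //.
- exact: integrable_gamma.
- under [X in _.-integrable _ X]funext do rewrite /= EFinD.
  by apply: integrableD => //; exact: iZ.
move=> t /=; rewrite in_itv/= andbT => t0.
by rewrite /gamma_integrand !mulrA -mulrDl ler_wpM2r ?expR_ge0// le.
Qed.

Lemma Gamma_convex x y s : 1 <= x -> 1 <= y -> 0 <= s <= 1 ->
  Gamma (s * x + (1 - s) * y) <= s * Gamma x + (1 - s) * Gamma y :> R.
Proof.
move=> x1 y1 s01; have /andP[s0 s1] := s01; apply: Gamma_le_comb => //.
  have : s * 1 <= s * x by rewrite ler_wpM2l.
  have : (1 - s) * 1 <= (1 - s) * y by rewrite ler_wpM2l ?subr_ge0.
  lra.
move=> t t0; rewrite !gt0_powRE//.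
rewrite (le_trans _ (expR_convex_comb _ _ s01))// ler_expR.
by rewrite le_eqVlt; apply/orP; left; apply/eqP; ring.
Qed.

(** Weighted arithmetic-geometric inequality: [t^(y+s-1) = y^s (t^y / y)^s (t^(y-1))^(1-s)] is at
    most [y^s (s t^y / y + (1-s) t^(y-1))], and [Gamma (y + 1) = y Gamma y] makes the integrated
    right-hand side collapse. This plays the part of log-convexity. *)
Lemma Gamma_powR_le y s : 1 <= y -> 0 <= s <= 1 ->
  Gamma (y + s) <= y `^ s * Gamma y :> R.
Proof.
move=> y1 s01; have /andP[s0 s1] := s01; have y0 : 0 < y by lra.
have h : Gamma (y + s) <= (y `^ s * (s / y)) * Gamma (y + 1) +
    (y `^ s * (1 - s)) * Gamma y :> R.
  apply: Gamma_le_comb => //; [lra|lra|move=> t t0; rewrite addrK].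
  have := expR_convex_comb (y * ln t - ln y) ((y - 1) * ln t) s01.
  have -> : expR (y * ln t - ln y) = t `^ y / y.
    by rewrite expRD expRN lnK ?posrE// gt0_powRE.
  rewrite -(gt0_powRE _ t0) => hc.
  have -> : t `^ (y + s - 1) = y `^ s *
      expR (s * (y * ln t - ln y) + (1 - s) * ((y - 1) * ln t)).
    by rewrite !gt0_powRE// -expRD; congr expR; ring.
  by rewrite -!mulrA -mulrDr ler_wpM2l ?powR_ge0// (mulrC y^-1).
apply: (le_trans h); rewrite GammaS// le_eqVlt; apply/orP; left; apply/eqP.
by field; rewrite gt_eqF.
Qed.

Lemma Gamma2 : Gamma 2 = 1 :> R.
Proof. by rewrite -(@natr1 R 1) GammaS// Gamma1 mulr1. Qed.

Lemma ln2_le : ln 2 <= 3 / 4 :> R.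
Proof.
rewrite -ler_expR lnK ?posrE//.
(* [exp(1/8) >= 9/8], and the sixth power of 9/8 exceeds 2. *)
have -> : 3 / 4 = 6%:R * (8%:R)^-1 :> R by lra.
rewrite expRM_natl; apply: (@le_trans _ _ ((1 + 8%:R^-1) ^+ 6)); first lra.
by rewrite lerXn2r ?nnegrE ?expR_ge0 ?expR_ge1Dx//; lra.
Qed.

(** [Gamma_powR_le] from [1 + x] to 2 gives [Gamma (1 + x) >= exp(- (1 - x) ln (1 + x))], which is
    at least [1 - (1 - x) ln 2]. The margin 1/4 is what [ln 2 <= 3/4] leaves, and it becomes the
    slope in [inv_Gamma_slope]. *)
Lemma Gamma_sub_ge x : 0 <= x <= 1 -> x + (1 - x) / 4 <= Gamma (1 + x) :> R.
Proof.
move=> /andP[x0 x1]; have x1p : 1 <= 1 + x by lra.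
have s01 : 0 <= 1 - x <= 1 by lra.
have := Gamma_powR_le x1p s01; rewrite (_ : 1 + x + (1 - x) = 2); last lra.
rewrite Gamma2 => h.
have g0 : 0 < (1 + x) `^ (1 - x) by rewrite powR_gt0; lra.
rewrite (@le_trans _ _ ((1 + x) `^ (1 - x))^-1)//; last by rewrite -div1r ler_pdivrMr// mulrC.
rewrite gt0_powRE; last lra.
rewrite -expRN (le_trans _ (expR_ge1Dx _))//.
have l2 : ln (1 + x) <= 3 / 4.
  by rewrite (le_trans _ ln2_le)// ler_ln ?posrE; lra.
have : (1 - x) * ln (1 + x) <= (1 - x) * (3 / 4) by rewrite ler_wpM2l//; lra.
lra.
Qed.

Lemma Gamma_gt0 x : 1 <= x -> 0 < Gamma x.
Proof.
move=> x1; have [n xn] : exists n : nat, x <= n%:R + 2.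
  by have := archi_boundP (le_trans ler01 x1) => xb; exists (Num.bound x); rewrite ltW//; lra.
elim: n x x1 xn => [|n IH] x x1 xn.
  have : 0 <= x - 1 <= 1 by move: xn; rewrite mulr0n; lra.
  by move=> /Gamma_sub_ge; rewrite subrKC; apply: lt_le_trans; lra.
have [x2|x2] := leP x 2.
  have : 0 <= x - 1 <= 1 by lra.
  by move=> /Gamma_sub_ge; rewrite subrKC; apply: lt_le_trans; lra.
rewrite -(subrK 1 x) GammaS; last lra.
rewrite mulr_gt0 ?IH//; [lra..|].
by move: xn; rewrite -natr1; lra.
Qed.

Lemma Gamma_le1 x : 0 <= x <= 1 -> Gamma (1 + x) <= 1 :> R.
Proof. by move=> /(Gamma_powR_le (lexx 1)); rewrite powR1 mul1r Gamma1. Qed.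

(** [gx] and [gy] stand for [Gamma (1 + x)] and [Gamma (1 + y)]; the last hypothesis puts the point
    at [y] below the chord from [x] to 1, where the value is 1. It yields [(1 - x) (y gx - x gy) >=
    (y - x) (gx - x)], and dividing by [gx gy <= 1] preserves the lower bound. *)
Lemma slope_of_chord x y gx gy : 0 <= x -> x < y -> y <= 1 ->
  0 < gx <= 1 -> 0 < gy <= 1 -> x + (1 - x) / 4 <= gx ->
  (1 - x) * gy <= (1 - y) * gx + (y - x) ->
  (y - x) / 4 <= y / gy - x / gx.
Proof.
move=> x0 xy y1 /andP[gx0 gx1] /andP[gy0 gy1] gxge conv.
have x1 : 0 < 1 - x by lra.
have num : (y - x) / 4 <= y * gx - x * gy.
  rewrite -(ler_pM2l x1) mulrBr (mulrCA _ x).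
  have h1 : x * ((1 - x) * gy) <= x * ((1 - y) * gx + (y - x)) by rewrite ler_wpM2l.
  have h2 : (y - x) * ((1 - x) / 4) <= (y - x) * (gx - x) by apply: ler_wpM2l; lra.
  by lra.
have -> : y / gy - x / gx = (y * gx - x * gy) / (gx * gy).
  by field; rewrite !gt_eqF.
rewrite ler_pdivlMr ?mulr_gt0// (le_trans _ num)// ler_piMr//; first lra.
by rewrite mulr_ile1// ltW.
Qed.

Lemma Gamma_chord x y : 0 <= x -> x < y -> y <= 1 ->
  (1 - x) * Gamma (1 + y) <= (1 - y) * Gamma (1 + x) + (y - x) :> R.
Proof.
move=> x0 xy y1; have x1 : 0 < 1 - x by lra.
have s01 : 0 <= (1 - y) / (1 - x) <= 1.
  by rewrite divr_ge0 ?ler_pdivrMr//=; lra.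
have x11 : 1 <= 1 + x by lra.
have := Gamma_convex x11 (ler1n R 2) s01; rewrite Gamma2 mulr1.
have -> : (1 - y) / (1 - x) * (1 + x) + (1 - (1 - y) / (1 - x)) * 2 = 1 + y.
  by field; rewrite gt_eqF.
rewrite -(ler_pM2l x1) mulrDr.
have -> : (1 - x) * (1 - (1 - y) / (1 - x)) = y - x by field; rewrite gt_eqF.
by rewrite mulrA (mulrCA (1 - x)) divff ?gt_eqF// mulr1.
Qed.

(* [x / Gamma (1 + x) = 1 / Gamma x], extended by its limit 0 at [x = 0]. *)
Lemma inv_Gamma_slope x y : 0 <= x -> x < y -> y <= 1 ->
  (y - x) / 4 <= y / Gamma (1 + y) - x / Gamma (1 + x) :> R.
Proof.
move=> x0 xy y1.
have x01 : 0 <= x <= 1 by rewrite x0 ltW// (lt_le_trans xy).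
have y01 : 0 <= y <= 1 by rewrite y1 (le_trans x0)// ltW.
apply: slope_of_chord => //.
- by rewrite Gamma_gt0 ?lerDl// Gamma_le1.
- by rewrite Gamma_gt0 ?lerDl ?Gamma_le1//; case/andP: y01.
- exact: Gamma_sub_ge.
- exact: Gamma_chord.
Qed.

End gamma_inequalities.

(** * Explicit error bounds and limits with rates *)

Section estimates.
Context {R : realType}.
Local Notation mu := (@lebesgue_measure R).
Implicit Types (z w u v : R[i]).

Lemma is_derive_ge0_le (F h : R -> R) (a b : R) : a <= b ->
  (forall x, a <= x <= b -> is_derive x 1 F (h x)) ->
  (forall x, a <= x <= b -> {for x, continuous h}) ->
  (forall x, a <= x <= b -> 0 <= h x) -> F a <= F b.
Proof.
move=> ab dF ch h0; rewrite -subr_ge0 -(Rintegral_FTC ab dF ch).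
by apply: Rintegral_ge0 => x /=; rewrite in_itv/=; exact: h0.
Qed.

(** Integrate the derivative of [cexp] along the segment from [v] to [u], on which the real part
    stays below [m]. *)
Lemma normc_cexpB_le u v (m : R) : Re u <= m -> Re v <= m ->
  normc (cexp u - cexp v) <= 2 * (normc (u - v) * expR m).
Proof.
move=> um vm.
have dl t : cder (fun s : R => v + s%:C * (u - v)) (u - v) t.
  have := cderD (cder_cst v t) (cderM (cder_real t) (cder_cst (u - v) t)).
  by move/cder_eq; apply; ring.
have d1 t := cder_cexp (dl t).
have e1 : cexp u - cexp v = cint 0 1 (fun t : R => (u - v) * cexp (v + t%:C * (u - v))).
  rewrite (@cint_FTC _ 0 1 (fun t : R => cexp (v + t%:C * (u - v))))//.
    by rewrite mul1r mul0r addr0 subrKC.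
  move=> t _; apply: cdiffM; first exact: cdiff_cst.
  exact: cder_cdiff (d1 t).
rewrite e1; apply: le_trans (normc_cint_le_cst (k := normc (u - v) * expR m) _ _ _) _ => //.
- move=> t _; apply: cdiffM; first exact: cdiff_cst.
  exact: cder_cdiff (d1 t).
- move=> t /andP[t0 t1]; rewrite normcM ler_wpM2l ?normc_ge0// normc_cexp ler_expR.
  rewrite cReD cReM/= mul0r subr0 cReD cReN.
  have : (1 - t) * Re v <= (1 - t) * m by rewrite ler_wpM2l// subr_ge0.
  have : t * Re u <= t * m by rewrite ler_wpM2l.
  lra.
- by rewrite subr0 mulr1.
Qed.

(** The device behind the identities between limits: errors are estimated at finite [X], and the
    difference, being constant, must vanish. *)
Lemma normc_eq0_expRN z (K : R) :
  (forall X, 0 <= X -> normc z <= K * expR (- X)) -> z = 0.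
Proof.
move=> zK; apply: eq0_normc; apply/eqP; rewrite eq_le normc_ge0 andbT.
rewrite leNgt; apply/negP => z0.
have K0 : 0 <= K.
  have := zK 0 (lexx _); rewrite oppr0 expR0 mulr1; apply: le_trans; exact: ltW.
have := zK (K / normc z) (divr_ge0 K0 (ltW z0)).
rewrite expRN ler_pdivlMr ?expR_gt0// leNgt => /negP; apply.
rewrite (@lt_le_trans _ _ (normc z * (1 + K / normc z)))//.
  by rewrite mulrDr mulr1 mulrC divfK ?gt_eqF//; rewrite ltrDr.
by rewrite ler_wpM2l ?normc_ge0// expR_ge1Dx.
Qed.

(** In the variable [s = exp x] the majorant is [K exp(- c s) ds] along a ray, which has an explicit
    primitive. *)
Lemma tail_bound (f : R -> R[i]) (K c X Y : R) : 0 <= K -> 0 < c -> X <= Y ->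
  (forall x, X <= x <= Y -> cdiff f x) ->
  (forall x, X <= x <= Y -> normc (f x) <= K * expR (x - c * expR x)) ->
  normc (cint X Y f) <= 2 * (K / c * expR (- (c * expR X))).
Proof.
move=> K0 c0 XY df fK.
have dF (x : R) : is_derive x 1 (fun x => - (K / c) * expR (- c * expR x))
    (K * expR (x - c * expR x)).
  have d1 : is_derive x 1 (fun x => expR (- c * expR x))
      (expR (- c * expR x) * (- c * expR x)).
    exact: (@is_derive1_comp _ expR (fun x => - c * expR x)).
  apply: is_derive_eq; rewrite /GRing.scale/= !mulNr expRD.
  by field; rewrite gt_eqF.
have cF (x : R) : {for x, continuous (fun x => K * expR (x - c * expR x))}.
  apply: continuousM; first exact: cst_continuous.
  apply: continuous_comp; last exact: continuous_expR.
  apply: continuousB => //; apply: continuousM; first exact: cst_continuous.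
  exact: continuous_expR.
have ih := @continuous_integrable _ X Y _ (fun x _ => cF x).
rewrite (le_trans (normc_cint_le df ih fK))// ler_wpM2l//.
rewrite (Rintegral_FTC XY (fun x _ => dF x) (fun x _ => cF x)) !mulNr opprK.
by rewrite gerDr oppr_le0 mulr_ge0 ?expR_ge0// divr_ge0// ltW.
Qed.

(** A Cauchy criterion that keeps the rate. The limit of each part is the supremum of the lower
    bounds [v X - eps X], none of which exceeds an upper bound [v Y + eps Y]; the factor 2 adds the
    real and imaginary parts. *)
Lemma cauchy_bound_lim (u : R -> R[i]) (eps : R -> R) :
  (forall X Y, 0 <= X -> X <= Y -> normc (u Y - u X) <= eps X) ->
  exists L, forall X, 0 <= X -> normc (u X - L) <= 2 * eps X.
Proof.
move=> uC.
have real (v : R -> R) : (forall X Y, 0 <= X -> X <= Y -> `|v Y - v X| <= eps X) ->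
    exists l, forall X, 0 <= X -> `|v X - l| <= eps X.
  move=> vC; pose S := [set v X - eps X | X in [set X | 0 <= X]].
  have e0 X : 0 <= X -> 0 <= eps X.
    by move=> X0; have := vC X X X0 (lexx _); apply: le_trans.
  have Sub X : 0 <= X -> ubound S (v X + eps X).
    move=> X0 _ [Y /= Y0 <-].
    have [YX|XY] := leP Y X.
      have := vC Y X Y0 YX; rewrite ler_norml => /andP[]; have := e0 _ X0; lra.
    have := vC X Y X0 (ltW XY); rewrite ler_norml => /andP[]; have := e0 _ Y0; lra.
  have S0 : has_sup S.
    split; first by exists (v 0 - eps 0); exists 0 => //=.
    by exists (v 0 + eps 0); exact: Sub.
  exists (sup S) => X X0; rewrite ler_distl; apply/andP; split.
    rewrite lerBlDr; apply: ge_sup; [by case: S0|exact: Sub].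
  by rewrite -lerBlDr; apply: ub_le_sup; [by case: S0|exists X].
have [l1 h1] : exists l, forall X, 0 <= X -> `|Re (u X) - l| <= eps X.
  apply: real => X Y X0 XY; rewrite -cReN -cReD.
  by rewrite (le_trans (Re_le_normc _))// uC.
have [l2 h2] : exists l, forall X, 0 <= X -> `|Im (u X) - l| <= eps X.
  apply: real => X Y X0 XY; rewrite -cImN -cImD.
  by rewrite (le_trans (Im_le_normc _))// uC.
exists (l1 +i* l2) => X X0; rewrite (le_trans (normc_le_ReIm _))//.
by rewrite mulr_natl mulr2n lerD// ?cReD ?cImD ?cReN ?cImN ?h1 ?h2.
Qed.

Lemma cint_split (a b c : R) (f : R -> R[i]) : a <= b -> b <= c ->
  (forall x, a <= x <= c -> cdiff f x) ->
  cint a c f = cint a b f + cint b c f.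
Proof.
move=> ab bc df; have [i1 i2] := cdiff_integrable df.
have split (h : R -> R) : mu.-integrable `[a, c] (EFin \o h) ->
    \int[mu]_(x in `[a, c]) h x = \int[mu]_(x in `[a, b]) h x + \int[mu]_(x in `[b, c]) h x.
  move=> ih; have := @Rintegral_itvB _ h (BLeft a) (BRight c) b ih.
  rewrite !bnd_simp => /(_ ab bc); rewrite Rintegral_itv_obnd_cbnd.
    by move=> /eqP; rewrite subr_eq addrC => /eqP.
  by apply: integrableS ih => //; apply: subset_itvr; rewrite bnd_simp.
by apply: complex_ext; rewrite ?cReD ?cImD /cint/= split.
Qed.

End estimates.

(** * Hankel integrals over arcs *)

Section hankel_integral.
Context {R : realType}.
Local Notation mu := (@lebesgue_measure R).
Implicit Types (a c x y X Y theta : R) (w : R[i]).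

(* [arcint theta Y (hankel a)] is, up to the factor i, the integral of
   [exp s * s ^ (- a) ds] over the arc [s = exp (Y + i y)], [`|y| <= theta]. *)
Definition hankel a : R[i] -> R[i] := wkernel (1 - a) 0 0.

Lemma hankelE a w : hankel a w = cexp (cexp w + (1 - a)%:C * w).
Proof. by rewrite /hankel /wkernel mul0r cexp0 subr0 divr1. Qed.

Lemma normc_hankel a x y :
  normc (hankel a (x +i* y)) = expR (expR x * cos y + (1 - a) * x).
Proof. by rewrite hankelE normc_cexp/= mul0r subr0. Qed.

Lemma hankel_denominator x y : 1 <= normc (cexp (0%:C * (x +i* y)) - 0 : R[i]).
Proof. by rewrite mul0r cexp0 subr0 normc1. Qed.

Lemma cdiff_hankel a (f : R -> R[i]) t :
  cdiff f t -> cdiff (fun s => hankel a (f s)) t.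
Proof.
move=> [d fd]; apply: cder_cdiff (cder_wkernel _ _ fd).
by rewrite mul0r cexp0 subr0 oner_neq0.
Qed.

Lemma cdiff_hline y t : cdiff (fun s : R => s +i* y) t.
Proof. exact: cder_cdiff (cder_hline _ _). Qed.

Lemma cdiff_vline x t : cdiff (fun s : R => x +i* s) t.
Proof. exact: cder_cdiff (cder_vline _ _). Qed.

Lemma hankel_shift a theta X Y : 0 <= theta -> X <= Y ->
  arcint theta Y (hankel a) - arcint theta X (hankel a) =
  - 'i%C * cint X Y (fun x => hankel a (x +i* theta) - hankel a (x +i* (- theta))).
Proof.
move=> t0 XY; apply: wkernel_shift (ltr01) t0 _ XY => x y _.
exact: hankel_denominator.
Qed.

(** Two arcs differ by the integrals along the two rays, where [exp s] has modulus [exp(- c |s|)]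
    and [s^(- a)] is largest at the inner radius. *)
Lemma arc_hankel_cauchy a c theta X Y : 0 <= a -> 0 < c -> cos theta = - c ->
  0 <= theta -> X <= Y ->
  normc (arcint theta Y (hankel a) - arcint theta X (hankel a)) <=
  4 / c * expR (- (a * X)) * expR (- (c * expR X)).
Proof.
move=> a0 c0 tc t0 XY; rewrite hankel_shift// normcM normcN normc_i mul1r.
have e0 : 0 <= 2 * expR (- (a * X)) by rewrite mulr_ge0 ?expR_ge0.
apply: le_trans (tail_bound e0 c0 XY _ _) _.
- by move=> x _; apply: cdiffB; apply: cdiff_hankel; exact: cdiff_hline.
- move=> x /andP[Xx xY]; rewrite (le_trans (normcB _ _))// !normc_hankel cosN tc.
  have aXx : a * X <= a * x by rewrite ler_wpM2l.
  by rewrite -mulrA mulr_natl mulr2n lerD// -expRD ler_expR; lra.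
- by rewrite le_eqVlt; apply/orP; left; apply/eqP; field; rewrite gt_eqF.
Qed.

Lemma hankel_rec a x y : hankel a (x +i* y) - a%:C * hankel (a + 1) (x +i* y) =
  (cexp (x +i* y) - a%:C) * cexp (cexp (x +i* y) - a%:C * (x +i* y)).
Proof.
rewrite !hankelE; set w := x +i* y.
have -> : cexp w + (1 - a)%:C * w = (cexp w - a%:C * w) + w.
  by rewrite rmorphB/= rmorph1; ring.
have -> : cexp w + (1 - (a + 1))%:C * w = cexp w - a%:C * w.
  by rewrite opprD addrCA subrr addr0 rmorphN/= mulNr.
by rewrite cexpD; ring.
Qed.

(** Integration by parts: [E] is [exp s] times [s^(- a)], and the combined integrand is its
    derivative in [w]. At both ends of the full arc [s = - exp X], where [E] is at most
    [exp(- X)]. *)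
Lemma arc_hankel_rec a X : 0 <= X -> 0 <= a ->
  normc (arcint pi X (hankel a) - a%:C * arcint pi X (hankel (a + 1))) <= 2 * expR (- X).
Proof.
move=> X0 a0; rewrite /arcint -cintZ; last first.
  by move=> y _; apply: cdiff_hankel; exact: cdiff_vline.
rewrite -cintB; last 2 first.
- by move=> y _; apply: cdiff_hankel; exact: cdiff_vline.
- move=> y _; apply: cdiffM; first exact: cdiff_cst.
  by apply: cdiff_hankel; exact: cdiff_vline.
pose E w := cexp (cexp w - a%:C * w).
have dE y : cder (fun y => E (X +i* y))
    ('i%C * ((cexp (X +i* y) - a%:C) * E (X +i* y))) y.
  have d1 := cder_cexp (cder_vline X y).
  have d2 := cderM (cder_cst a%:C y) (cder_vline X y).
  apply: (cder_eq (cder_cexp (cderB d1 d2))).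
  by rewrite /E; ring.
have ddE y : cdiff (fun y => 'i%C * ((cexp (X +i* y) - a%:C) * E (X +i* y))) y.
  apply: cdiffM; first exact: cdiff_cst.
  apply: cdiffM; last exact: cder_cdiff (dE y).
  apply: cdiffB; last exact: cdiff_cst.
  by apply: cdiff_cexp; exact: cdiff_vline.
have pi0 : - pi <= pi :> R by rewrite ge0_cp ?pi_ge0.
have -> : cint (- pi) pi (fun x => hankel a (X +i* x) - a%:C * hankel (a + 1) (X +i* x)) =
    - 'i%C * cint (- pi) pi (fun y => 'i%C * ((cexp (X +i* y) - a%:C) * E (X +i* y))).
  rewrite -cintZ//; apply: eq_cint => y _.
  by rewrite hankel_rec mulrA mulNr -expr2 sqr_i opprK mul1r.
rewrite (cint_FTC pi0 (fun y _ => dE y) (fun y _ => ddE y)).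
rewrite normcM normcN normc_i mul1r (le_trans (normcB _ _))//.
rewrite /E !normc_cexp !cReD !cReN !cReM /= cosN cospi !mul0r !subr0.
have aX : 0 <= a * X by rewrite mulr_ge0.
by have := expR_ge1Dx X => eX; rewrite mulr_natl mulr2n lerD// ler_expR mulrN1; lra.
Qed.

Lemma cexp_pi x : cexp (x +i* pi) = - (expR x)%:C.
Proof. by apply: complex_ext; rewrite /cexp/= ?cospi ?sinpi; ring. Qed.

Lemma cexp_Npi x : cexp (x +i* (- pi)) = - (expR x)%:C.
Proof. by apply: complex_ext; rewrite /cexp/= ?cosN ?sinN ?cospi ?sinpi; ring. Qed.

(** For exponent 1 the integrand takes the same value on both sides of the cut, so the two rays
    cancel. *)
Lemma arc_hankel1 X Y : X <= Y -> arcint pi Y (hankel 1) = arcint pi X (hankel 1) :> R[i].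
Proof.
move=> XY; apply/eqP; rewrite -subr_eq0 hankel_shift ?pi_ge0//.
rewrite (@eq_cint _ X Y _ (fun=> 0 * 0)).
  by rewrite cintZ ?mul0r ?mulr0// => x _; exact: cdiff_cst.
by move=> x _; rewrite !hankelE subrr !mul0r !addr0 cexp_pi cexp_Npi subrr.
Qed.

Lemma cint_cst (a' b' : R) (z : R[i]) : a' <= b' ->
  cint a' b' (fun=> z) = (b' - a')%:C * z.
Proof.
move=> ab; rewrite (@cint_FTC _ a' b' (fun t => t%:C * z))//.
- by rewrite rmorphB/= mulrBl.
- move=> t _; apply: (cder_eq (cderM (cder_real t) (cder_cst z t))).
  by rewrite mul1r mulr0 addr0.
- by move=> t _; exact: cdiff_cst.
Qed.

(** The residue of [exp s / s] at 0: the radius may be shrunk to [exp(- X)], where the integrand is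
    within [O(exp(- X))] of 1. *)
Lemma arc_hankel1_value : arcint pi 0 (hankel 1) = (2 * pi)%:C :> R[i].
Proof.
apply/eqP; rewrite -subr_eq0; apply/eqP.
apply: (@normc_eq0_expRN _ _ (2 * (2 * expR 1 * (pi + pi)))) => X X0.
have X0' : - X <= 0 by rewrite oppr_le0.
have pi0 : - pi <= pi :> R by rewrite ge0_cp ?pi_ge0.
rewrite (arc_hankel1 X0').
have -> : (2 * pi)%:C = cint (- pi) pi (fun=> 1) :> R[i].
  by rewrite cint_cst// mulr1 opprK mulr_natl mulr2n.
rewrite /arcint -cintB; last 2 first.
- by move=> y _; apply: cdiff_hankel; exact: cdiff_vline.
- by move=> y _; exact: cdiff_cst.
apply: le_trans (normc_cint_le_cst (k := 2 * (expR (- X) * expR 1)) pi0 _ _) _.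
- move=> y _; apply: cdiffB; last exact: cdiff_cst.
  by apply: cdiff_hankel; exact: cdiff_vline.
- move=> y _; rewrite hankelE subrr mul0r addr0 -cexp0.
  rewrite (le_trans (@normc_cexpB_le _ _ _ 1 _ _))//.
  + rewrite /= (@le_trans _ _ (expR (- X)))// ?expR_le1//.
    by rewrite ler_piMr ?expR_ge0 ?cos_le1.
  + by rewrite subr0 normc_cexp.
- by rewrite le_eqVlt; apply/orP; left; apply/eqP; rewrite opprK; ring.
Qed.

End hankel_integral.

(** * Real estimates for the saddle point and Stirling's bound *)

Section asymptotics.
Context {R : realType}.
Local Notation mu := (@lebesgue_measure R).
Implicit Types (x y : R).

(** Up to 1, integrating [sin y >= y cos 1] gives the constant [cos 1 / 2]. From 1 to [pi],
    [1 - cos y] is at least [1 - cos 1] while [y^2 <= pi^2 <= 16]. *)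
Lemma cos_quadratic_bound :
  exists2 k : R, 0 < k & forall y, `|y| <= pi -> k * y ^+ 2 <= 1 - cos y.
Proof.
have c1 : 0 < cos 1 :> R by exact: cos1_gt0.
have pi2 : 2 <= pi :> R by exact: pi_ge2.
have c1' : cos 1 < 1 :> R.
  by rewrite -[ltRHS]cos0 ltr_cos ?in_itv/= ?lexx ?pi_ge0//; lra.
have cc (f : R -> R) x : derivable f x 1 -> {for x, continuous f}.
  by move=> df; apply: differentiable_continuous; exact/derivable1_diffP.
have E0 y : 0 <= y <= 1 -> 0 <= sin y - cos 1 * y.
  move=> /andP[y0 y1].
  have -> : 0 = sin 0 - cos 1 * 0 :> R by rewrite sin0; ring.
  apply: (@is_derive_ge0_le _ (fun y => sin y - cos 1 * y) (fun y => cos y - cos 1)) => //.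
  - by move=> x _; apply: is_derive_eq; rewrite /GRing.scale/=; ring.
  - by move=> x _; apply: cc.
  - move=> x /andP[x0 xy]; rewrite subr_ge0 leNgt ltr_cos ?in_itv/=; lra.
have D0 y : 0 <= y <= 1 -> cos 1 / 2 * y ^+ 2 <= 1 - cos y.
  move=> /andP[y0 y1]; rewrite -subr_ge0.
  have -> : 0 = 1 - cos 0 - cos 1 / 2 * 0 ^+ 2 :> R by rewrite cos0; ring.
  apply: (@is_derive_ge0_le _ (fun y => 1 - cos y - cos 1 / 2 * y ^+ 2)
    (fun y => sin y - cos 1 * y)) => //.
  - by move=> x _; apply: is_derive_eq; rewrite /GRing.scale/= ?expr1; field.
  - by move=> x _; apply: cc.
  - by move=> x /andP[x0 xy]; apply: E0; lra.
exists (Num.min (cos 1 / 2) ((1 - cos 1) / 16)).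
  by rewrite lt_min !divr_gt0//; lra.
move=> y; rewrite -[cos y]cos_norm -(real_normK (num_real y)).
set v := `|y|; have v0 : 0 <= v by rewrite normr_ge0.
move=> vpi; move: v v0 vpi => {}y y0 ypi.
have y20 : 0 <= y ^+ 2 by rewrite sqr_ge0.
have [y1|y1] := leP y 1.
  rewrite (le_trans _ (D0 y _)) ?y0// ler_wpM2r//.
  by rewrite ge_min lexx.
have cy : cos y <= cos 1 by rewrite leNgt ltr_cos ?in_itv/=; lra.
have y4 : y ^+ 2 <= 16.
  have p4 : pi <= 4 :> R by have := @pihalf_lt2 R; lra.
  have -> : 16 = 4 ^+ 2 :> R by ring.
  by rewrite lerXn2r ?nnegrE//; lra.
rewrite (@le_trans _ _ ((1 - cos 1) / 16 * 16))//; last by lra.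
rewrite ler_pM ?le_min//; last by rewrite ge_min lexx orbT.
by apply/andP; split; lra.
Qed.

(** Trades a Gaussian for a Cauchy density, whose primitive is an arctangent. With [u = (s y)^2], it
    combines [2 s |y| <= 1 + u] and [(1 + u)^2 <= 4 exp u]. *)
Lemma normr_gauss_le (s y : R) : 0 < s ->
  `|y| * expR (- (s * y) ^+ 2) <= 2 / s * (1 + (s * y) ^+ 2)^-1.
Proof.
move=> s0; set u := (s * y) ^+ 2.
have u0 : 0 <= u by rewrite sqr_ge0.
have vle : s * `|y| <= (1 + u) / 2.
  rewrite -[s in leLHS](gtr0_norm s0) -normrM /u -(real_normK (num_real (s * y))).
  by have := sqr_ge0 (`|s * y| - 1); rewrite sqrrB; lra.
have eu : (1 + u) ^+ 2 <= 4 * expR u.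
  have -> : expR u = expR (u / 2) ^+ 2.
    by rewrite -expRM_natl; congr expR; field.
  have := expR_ge1Dx (u / 2) => h.
  have h2 : (1 + u / 2) ^+ 2 <= expR (u / 2) ^+ 2.
    by rewrite lerXn2r ?nnegrE ?expR_ge0//; lra.
  rewrite (@le_trans _ _ (4 * (1 + u / 2) ^+ 2))//; last by rewrite ler_wpM2l.
  have -> : 4 * (1 + u / 2) ^+ 2 = (1 + u) ^+ 2 + (3 + 2 * u) by field.
  by rewrite lerDl; lra.
have u1 : 0 < 1 + u by lra.
rewrite expRN ler_pdivrMr ?expR_gt0// -(ler_pM2l s0).
have -> : s * (2 / s * (1 + u)^-1 * expR u) = 2 * expR u / (1 + u).
  by field; rewrite !gt_eqF.
rewrite ler_pdivlMr// (le_trans (ler_wpM2r (ltW u1) vle))//.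
by move: eu; rewrite expr2; lra.
Qed.

Lemma Rintegral_cauchy_le (s a b : R) : 0 < s -> a <= b ->
  \int[mu]_(y in `[a, b]) (1 + (s * y) ^+ 2)^-1 <= pi / s.
Proof.
move=> s0 ab.
have dF (y : R) : is_derive y 1 (fun y => s^-1 * atan (s * y)) (1 + (s * y) ^+ 2)^-1.
  have d1 : is_derive y 1 (fun y => atan (s * y)) ((1 + (s * y) ^+ 2)^-1 * s).
    by apply: (@is_derive1_comp _ atan (fun y => s * y));
      apply: is_derive_eq; rewrite /GRing.scale/=; ring.
  apply: is_derive_eq; rewrite /GRing.scale/=.
  by set q := (1 + _)^-1; field; rewrite gt_eqF.
have cF (y : R) : {for y, continuous (fun y => (1 + (s * y) ^+ 2)^-1)}.
  apply: continuousV; first by rewrite gt_eqF// ltr_pwDl// sqr_ge0.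
  apply: differentiable_continuous; exact/derivable1_diffP.
rewrite (Rintegral_FTC ab (fun x _ => dF x) (fun x _ => cF x)).
rewrite -mulrBr mulrC ler_wpM2r ?invr_ge0 ?(ltW s0)//.
have := atan_ltpi2 (s * b); have := atan_gtNpi2 (s * a); lra.
Qed.

(** The difference vanishes at 0 and has a nonnegative derivative. At [u = 1 / N] the bound reads
    [(N + 1/2) ln(1 + 1/N) >= 1], the induction step of [Gamma_stirling_le]. *)
Lemma ln1D_ge (u : R) : 0 <= u -> 2 * u / (2 + u) <= ln (1 + u).
Proof.
move=> u0; rewrite -subr_ge0.
have -> : 0 = ln (1 + 0) - 2 * 0 / (2 + 0) :> R by rewrite addr0 ln1; ring.
apply: (@is_derive_ge0_le _ (fun u => ln (1 + u) - 2 * u / (2 + u))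
  (fun u => u ^+ 2 / ((1 + u) * (2 + u) ^+ 2))) => //.
- move=> v /andP[v0 _].
  have d1 : is_derive v 1 (fun u => ln (1 + u)) ((1 + v)^-1 * 1).
    apply: (@is_derive1_comp _ (@ln R) (fun u => 1 + u)).
      by apply: is_derive1_ln; lra.
    by apply: is_derive_eq; ring.
  have n2 : 2 + v != 0 by rewrite gt_eqF//; lra.
  have d2 : is_derive v 1 (fun u : R => (2 + u)^-1) (- (2 + v) ^- 2 *: 1).
    apply: realfun.is_deriveV => //.
    by apply: is_derive_eq; ring.
  apply: is_derive_eq; rewrite /GRing.scale/=.
  by field; rewrite n2 gt_eqF//; lra.
- move=> v /andP[v0 _]; apply: differentiable_continuous; apply/derivable1_diffP.
  apply: derivableM => //; apply: derivableV => //.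
  by rewrite gt_eqF// mulr_gt0 ?exprn_gt0//; lra.
- by move=> v /andP[v0 _]; rewrite divr_ge0 ?mulr_ge0 ?sqr_ge0//; lra.
Qed.

Local Opaque Gamma.

(** The left side is nonincreasing in [N] and equals [e] at [N = 1]. The shift by 1/2 matters:
    against the saddle point bound [exp(N - N ln N)] it leaves a factor [1 / sqrt N]. *)
Lemma Gamma_stirling_le (n : nat) : let N : R := n.+1%:R in
  Gamma N * expR (N - (N - 2^-1) * ln N) <= expR 1.
Proof.
elim: n => [|n IH] /=.
  by rewrite Gamma1 mul1r ln1 mulr0 subr0.
rewrite -natr1; set N : R := n.+1%:R in IH *.
have N1 : 1 <= N by rewrite ler1n.
have N0 : 0 < N by lra.
rewrite GammaS//; apply: le_trans IH.
rewrite mulrAC mulrC ler_wpM2l ?(ltW (Gamma_gt0 N1))//.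
have mulNE (A : R) : N * expR A = expR (ln N + A) by rewrite expRD lnK ?posrE.
rewrite mulNE ler_expR.
have := @ln1D_ge N^-1; rewrite invr_ge0 (ltW N0) => /(_ isT).
have -> : 2 * N^-1 / (2 + N^-1) = (N + 2^-1)^-1.
  by field; rewrite !gt_eqF//; lra.
have -> : 1 + N^-1 = (N + 1) / N by field; rewrite gt_eqF.
rewrite ln_div ?posrE//; last lra.
rewrite -(@ler_pM2l _ (N + 2^-1)); last lra.
rewrite divff ?gt_eqF//; last lra.
lra.
Qed.

Lemma normc_eq0_invsqrt (z : R[i]) (K : R) :
  (forall n : nat, normc z <= K * expR (- (ln n.+1%:R / 2))) -> z = 0.
Proof.
move=> zK.
have K0 : 0 <= K.
  have := zK 0%N; rewrite ln1 mul0r oppr0 expR0 mulr1; apply: le_trans; exact: normc_ge0.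
apply: (@normc_eq0_expRN _ z K) => X X0.
set n := Num.bound (expR (2 * X)).
rewrite (le_trans (zK n))// ler_wpM2l// ler_expR lerN2.
have : expR (2 * X) <= n.+1%:R.
  have := archi_boundP (expR_ge0 (2 * X)) => /ltW/le_trans; apply.
  by rewrite ler_nat.
rewrite -ler_ln ?posrE ?expR_gt0// expRK; lra.
Qed.

End asymptotics.

(** * The limit over growing arcs and its shift by a fraction *)

Section hankel_limit.
Context {R : realType}.
Local Notation mu := (@lebesgue_measure R).
Implicit Types (a c x y X Y theta : R) (w : R[i]).
Local Opaque Gamma.

(** [L a] is [2 pi h(a)] in the notation of the overview. The rate belongs to the definition, with a
    constant independent of [a], because it is used with [a] and the radius growing together. *)
Definition hankel_limit (L : R -> R[i]) := forall a X, 0 <= a -> 0 <= X ->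
  normc (arcint pi X (hankel a) - L a) <=
  8 * expR (- (a * X)) * expR (- expR X).

Lemma hankel_limit_exists : exists L, hankel_limit L.
Proof.
have h a : exists l, 0 <= a -> forall X, 0 <= X ->
    normc (arcint pi X (hankel a) - l) <= 8 * expR (- (a * X)) * expR (- expR X).
  (* Negative exponents are outside the claim; 0 is a placeholder there. *)
  have [a0|a0] := leP 0 a; last by exists 0.
  have [|l lP] := @cauchy_bound_lim R (fun X => arcint pi X (hankel a))
    (fun X => 4 * expR (- (a * X)) * expR (- expR X)).
    move=> X Y X0 XY.
    have := @arc_hankel_cauchy R a 1 pi X Y a0 ltr01 (cospi R) (pi_ge0 R) XY.
    by rewrite divr1 mul1r.
  exists l => _ X X0; rewrite (le_trans (lP X X0))// !mulrA.
  by rewrite le_eqVlt; apply/orP; left; apply/eqP; ring.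
have [L LP] := choice h.
by exists L => a X a0 X0; exact: LP.
Qed.

Context (L : R -> R[i]) (LP : hankel_limit L).

Lemma expR_expR_le X : expR (- expR X) <= expR (- X).
Proof. by rewrite ler_expR lerN2 (le_trans _ (expR_ge1Dx X))// lerDr. Qed.

Lemma hankel_limit_le a X : 0 <= a -> 0 <= X ->
  normc (arcint pi X (hankel a) - L a) <= 8 * expR (- X).
Proof.
move=> a0 X0; rewrite (le_trans (LP a0 X0))// -mulrA ler_wpM2l//.
rewrite (le_trans _ (expR_expR_le X))// ler_piMl ?expR_ge0//.
by rewrite expR_le1 oppr_le0 mulr_ge0.
Qed.

Lemma hankel_limit_rec a : 0 <= a -> L a = a%:C * L (a + 1).
Proof.
move=> a0; apply/eqP; rewrite -subr_eq0; apply/eqP.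
apply: (@normc_eq0_expRN _ _ (8 + 2 + a * 8)) => X X0.
have a10 : 0 <= a + 1 by rewrite addr_ge0.
have h0 := hankel_limit_le a0 X0; have h1 := hankel_limit_le a10 X0.
have h2 := arc_hankel_rec X0 a0.
set A := arcint pi X (hankel a) in h0 h2; set B := arcint pi X _ in h1 h2.
have -> : L a - a%:C * L (a + 1) =
    - (A - L a) + (A - a%:C * B) + a%:C * (B - L (a + 1)) by ring.
rewrite (le_trans (normc_triangle _ _))// mulrDl lerD//.
  by rewrite (le_trans (normc_triangle _ _))// mulrDl lerD// normcN.
by rewrite normcM normc_real ger0_norm// -mulrA ler_wpM2l.
Qed.

Lemma hankel_limit1 : L 1 = (2 * pi)%:C.
Proof.
apply/eqP; rewrite eq_sym -subr_eq0; apply/eqP.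
apply: (@normc_eq0_expRN _ _ 8) => X X0.
by rewrite -arc_hankel1_value -(arc_hankel1 X0) hankel_limit_le.
Qed.

Lemma hankel_limit_Gamma_shift a : 1 <= a ->
  L (a + 1) * (Gamma (a + 1))%:C = L a * (Gamma a)%:C.
Proof.
move=> a1; have a0 : 0 <= a by exact: le_trans a1.
rewrite (GammaS a1) (hankel_limit_rec a0).
by move: (Gamma a) (L (a + 1)) => g l; rewrite rmorphM/=; ring.
Qed.

Lemma shift_invariant_nat (P : R -> R[i]) : (forall a, 1 <= a -> P (a + 1) = P a) ->
  forall (n : nat) x, 0 <= x -> P (n.+1%:R + x) = P (1 + x).
Proof.
move=> PS n x x0; elim: n => // n <-.
rewrite -[RHS]PS; last by rewrite ler_wpDr// ler1n.
by rewrite (addrAC n.+1%:R) natr1.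
Qed.

(* The arc of radius [N] passes through the saddle point of
   [exp s * s ^ (- N)]; the factor [1 - exp (- i x y)] vanishes there, which
   gains a factor of order [1 / sqrt N] over [arcint pi (ln N) (hankel N)]. *)
Lemma arc_hankel_shift_le : exists C, forall (n : nat) x, 0 <= x <= 1 ->
  let N : R := n.+1%:R in
  normc ((N `^ x)%:C * arcint pi (ln N) (hankel (N + x)) -
         arcint pi (ln N) (hankel N)) <= C * expR (N - N * ln N).
Proof.
have [k k0 kP] := @cos_quadratic_bound R.
exists (8 * pi / k) => n x /andP[x0 x1]; cbv zeta; set N : R := n.+1%:R.
have N1 : 1 <= N by rewrite ler1n.
have N0 : 0 < N by rewrite (lt_le_trans ltr01).
set X := ln N; have NX : expR X = N by rewrite lnK.
have pi0 : - pi <= pi :> R by rewrite ge0_cp ?pi_ge0.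
have dh a y : cdiff (fun y => hankel a (X +i* y)) y.
  by apply: cdiff_hankel; exact: cdiff_vline.
rewrite /arcint -cintZ; last by move=> y _; exact: dh.
rewrite -cintB; last 2 first.
- by move=> y _; apply: cdiffM => //; exact: cdiff_cst.
- by move=> y _; exact: dh.
(* This scale makes [k N y^2 = (s y)^2]; the final bound is of order [N E / s^2], in which [N]
   cancels. *)
pose s := Num.sqrt (k * N).
have s0 : 0 < s by rewrite sqrtr_gt0 mulr_gt0.
have s2 : s ^+ 2 = k * N by rewrite sqr_sqrtr// ltW// mulr_gt0.
set E := expR (N - N * X).
pose K := N * E * (4 / s).
have K0 : 0 <= K by rewrite !mulr_ge0 ?expR_ge0 ?invr_ge0 ?(ltW s0) ?(ltW N0).
pose h y := K * (1 + (s * y) ^+ 2)^-1.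
have ch y : {for y, continuous (fun y => (1 + (s * y) ^+ 2)^-1)}.
  apply: continuousV; first by rewrite gt_eqF// ltr_pwDl// sqr_ge0.
  apply: differentiable_continuous; exact/derivable1_diffP.
have ih := @continuous_integrable _ (- pi) pi _ (fun y _ => ch y).
have ihK : mu.-integrable `[- pi, pi] (EFin \o h).
  by apply: continuous_integrable => y _; apply: continuousM => //; exact: cst_continuous.
apply: le_trans (normc_cint_le (h := h) _ ihK _) _.
- move=> y _; apply: cdiffB => //; apply: cdiffM => //; exact: cdiff_cst.
- move=> y ypi.
  (* On the circle of radius [N], [N^x s^(- x)] has modulus 1: it is [exp(- i x y)], within [2 |y|]
     of 1. *)
  have -> : (N `^ x)%:C * hankel (N + x) (X +i* y) - hankel N (X +i* y) =
      hankel N (X +i* y) * (cexp (0 +i* (- (x * y))) - cexp 0).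
    rewrite !hankelE (gt0_powRE _ N0) -/X -cexp_real.
    have -> : cexp (X +i* y) + (1 - (N + x))%:C * (X +i* y) =
        (cexp (X +i* y) + (1 - N)%:C * (X +i* y)) +
        (- (x * X)%:C + 0 +i* (- (x * y))).
      rewrite -addrA; congr (_ + _).
      by apply: complex_ext; rewrite ?(cReD, cImD, cReM, cImM, cReN, cImN)/=; ring.
    rewrite cexpD (cexpD (- (x * X)%:C)) cexpN cexp0 mulrBr mulr1.
    congr (_ - _); by rewrite mulrCA mulVKf ?cexp_neq0.
  rewrite normcM normc_hankel NX.
  have := @normc_cexpB_le R (0 +i* (- (x * y))) 0 0 (lexx _) (lexx _).
  rewrite subr0 expR0 mulr1 normc_sqrtE/= expr0n add0r sqrrN sqrtr_sqr normrM.
  rewrite (ger0_norm x0) => hx.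
  have hx' : normc (cexp (0 +i* (- (x * y))) - cexp 0) <= 2 * `|y|.
    by rewrite (le_trans hx)// ler_wpM2l// ler_piMl.
  have he : expR (N * cos y + (1 - N) * X) <= N * E * expR (- (s * y) ^+ 2).
    rewrite (_ : N * E = expR (X + (N - N * X))); last by rewrite expRD NX.
    rewrite -expRD ler_expR exprMn s2.
    have yp : `|y| <= pi by rewrite ler_norml.
    have : N * (k * y ^+ 2) <= N * (1 - cos y) by rewrite ler_wpM2l ?(ltW N0)// kP.
    lra.
  rewrite (le_trans (ler_pM (expR_ge0 _) (normc_ge0 _) he hx'))//.
  have := normr_gauss_le y s0 => hg.
  rewrite /h /K; set q := (1 + (s * y) ^+ 2)^-1 in hg *.
  have -> : N * E * expR (- (s * y) ^+ 2) * (2 * `|y|) =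
    (N * E * 2) * (`|y| * expR (- (s * y) ^+ 2)) by ring.
  have -> : N * E * (4 / s) * q = (N * E * 2) * (2 / s * q) by ring.
  by rewrite ler_wpM2l// !mulr_ge0 ?expR_ge0 ?(ltW N0).
rewrite RintegralZl// (@le_trans _ _ (2 * (K * (pi / s))))//.
  by rewrite !ler_wpM2l// Rintegral_cauchy_le.
rewrite le_eqVlt; apply/orP; left; apply/eqP; rewrite /K.
have -> : 2 * (N * E * (4 / s) * (pi / s)) = 8 * pi * N * E / s ^+ 2.
  by field; rewrite gt_eqF.
by rewrite s2; field; rewrite !gt_eqF.
Qed.

End hankel_limit.

(** * Identification of the limit with the inverse of Gamma *)

Section hankel_value.
Context {R : realType}.
Implicit Types (a c x y X Y theta : R) (w : R[i]).
Local Opaque Gamma.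
Context (L : R -> R[i]) (LP : hankel_limit L).

(** [arc_hankel_shift_le] passed to the limit. At radius [N] each of the two truncation errors is at
    most [8 N^(- N) exp(- N)], the factor [N^x] cancelling again; they account for the added 16. *)
Lemma hankel_limit_asymp : exists2 C, 0 <= C & forall (n : nat) x, 0 <= x <= 1 ->
  let N : R := n.+1%:R in
  normc ((N `^ x)%:C * L (N + x) - L N) <= C * expR (N - N * ln N).
Proof.
have [C CP] := @arc_hankel_shift_le R.
have C0 : 0 <= C.
  have := CP 0%N 0; rewrite lexx ler01 => /(_ isT); cbv zeta.
  move=> h; have := le_trans (normc_ge0 _) h.
  by rewrite pmulr_lge0// expR_gt0.
exists (C + 16) => [|n x x01]; first by rewrite addr_ge0.
have := CP n x x01; cbv zeta; set N : R := n.+1%:R => h.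
have /andP[x0 x1] := x01.
have N1 : 1 <= N by rewrite ler1n.
have N0 : 0 < N by rewrite (lt_le_trans ltr01).
set X := ln N in h *; have NX : expR X = N by rewrite lnK.
have X0 : 0 <= X by rewrite ln_ge0.
have Nx0 : 0 <= N + x by rewrite addr_ge0// ltW.
have h1 := LP Nx0 X0; have h2 := LP (ltW N0) X0; rewrite NX in h1 h2.
set A := arcint pi X (hankel (N + x)) in h h1.
set B := arcint pi X (hankel N) in h h2.
set E := expR (N - N * X) in h *.
have eE : expR (- (N * X)) * expR (- N) <= E.
  by rewrite -expRD ler_expR; lra.
have -> : (N `^ x)%:C * L (N + x) - L N =
    ((N `^ x)%:C * A - B) - (N `^ x)%:C * (A - L (N + x)) + (B - L N) by ring.
rewrite (le_trans (normc_triangle _ _))// (_ : _ * E = C * E + 8 * E + 8 * E); last by ring.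
rewrite lerD//.
  rewrite (le_trans (normcB _ _))// lerD// normcM normc_real ger0_norm ?powR_ge0//.
  rewrite (le_trans (ler_wpM2l (powR_ge0 _ _) h1))// (gt0_powRE _ N0) -/X.
  rewrite mulrCA -!mulrA ler_wpM2l// mulrA -expRD.
  by rewrite (_ : - ((N + x) * X) + x * X = - (N * X)); [|ring].
by rewrite (le_trans h2)// -mulrA ler_wpM2l.
Qed.

(** [Gamma_powR_le] twice: from [N] to [N + x] for the upper bound, from [N + x] to [N + 1] for the
    lower one. *)
Lemma Gamma_ratio_bounds (N x : R) : 1 <= N -> 0 <= x <= 1 ->
  N / (N + 1) <= Gamma (N + x) / (N `^ x * Gamma N) <= 1.
Proof.
move=> N1 x01; have /andP[x0 x1] := x01; have N0 : 0 < N by lra.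
have Nx1 : 1 <= N + x by lra.
have g0 := Gamma_gt0 N1; have h1 := Gamma_powR_le N1 x01.
have s01 : 0 <= 1 - x <= 1 by lra.
have := Gamma_powR_le Nx1 s01; rewrite (_ : N + x + (1 - x) = N + 1); last by ring.
rewrite (GammaS N1); move: (Gamma_gt0 Nx1) h1 g0.
move: (Gamma (N + x)) (Gamma N) => gx g gx0 h1 g0 h2.
have p0 : 0 < N `^ x by exact: powR_gt0.
apply/andP; split; last by rewrite ler_pdivrMr ?mulr_gt0// mul1r.
have q1 : 1 <= (N + x) / N by rewrite ler_pdivlMr// mul1r; lra.
have h3 : N * g <= N `^ (1 - x) * ((N + x) / N) * gx.
  rewrite (le_trans h2)// ler_wpM2r ?(ltW gx0)//.
  rewrite -{1}(divfK (lt0r_neq0 N0) (N + x)) (mulrC _ N) powRM ?(ltW N0)//; last lra.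
  rewrite ler_wpM2l ?powR_ge0// ler1_powR//; lra.
have h4 : N `^ x * g <= (N + x) / N * gx.
  rewrite -(@ler_pM2l _ (N `^ (1 - x))) ?powR_gt0//.
  rewrite mulrA -powRD ?subrK ?powRr1 ?(ltW N0)//; last by rewrite (gt_eqF N0) implybT.
  by rewrite mulrA.
rewrite ler_pdivlMr ?mulr_gt0// mulrAC ler_pdivrMr; last lra.
rewrite (@le_trans _ _ (N * ((N + x) / N * gx)))//; first by rewrite ler_wpM2l// ltW.
rewrite mulrA mulrCA divff ?gt_eqF// mulr1 mulrC ler_wpM2l ?(ltW gx0)//; lra.
Qed.

(** [P] is invariant under unit shifts from 1 on, so [P (1 + x)] equals [P (N + x)] for every
    integer [N >= 1], while [P N = 2 pi]; their difference is shown to be [O(1 / sqrt N)]. *)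
Lemma hankel_limit_Gamma01 x : 0 <= x <= 1 ->
  L (1 + x) * (Gamma (1 + x))%:C = (2 * pi)%:C.
Proof.
move=> x01; have /andP[x0 x1] := x01.
have [C C0 CP] := hankel_limit_asymp.
pose P a := L a * (Gamma a)%:C.
have PS a : 1 <= a -> P (a + 1) = P a by exact: hankel_limit_Gamma_shift.
rewrite -/(P (1 + x)).
apply/eqP; rewrite -subr_eq0; apply/eqP.
apply: (@normc_eq0_invsqrt _ _ (C * expR 1 + 2 * pi)) => n.
rewrite -(shift_invariant_nat PS n x0).
have := @Gamma_stirling_le R n; have := CP n x x01; cbv zeta.
have PN : P n.+1%:R = (2 * pi)%:C.
  have := shift_invariant_nat PS n (lexx 0); rewrite !addr0 => ->.
  by rewrite /P Gamma1 mulr1 (hankel_limit1 LP).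
have N1 : 1 <= n.+1%:R :> R by rewrite ler1n.
move: PN; rewrite /P; set N : R := n.+1%:R in N1 *.
have N0 : 0 < N by rewrite (lt_le_trans ltr01).
have := Gamma_ratio_bounds N1 x01; have := Gamma_gt0 N1.
move: (Gamma (N + x)) (Gamma N) (L (N + x)) (L N) => gx g l1 l0 g0.
set p := N `^ x; have p0 : 0 < p by exact: powR_gt0.
set r := gx / _ => /andP[rge rle] lg hE hS.
have r0 : 0 <= r by rewrite (le_trans _ rge)// divr_ge0//; lra.
(* The first term is the saddle point error, made small by Stirling's bound; the second is the
   defect [1 - r], at most [1 / N], of the ratio of Gamma values. *)
have -> : l1 * gx%:C - (2 * pi)%:C =
    r%:C * ((p%:C * l1 - l0) * g%:C) + (r - 1)%:C * (2 * pi)%:C.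
  have -> : gx = r * (p * g) by rewrite /r divfK// gt_eqF// mulr_gt0.
  rewrite -lg [(r - 1)%:C]rmorphB/= !rmorphM/= rmorph1; ring.
rewrite (le_trans (normc_triangle _ _))// [leRHS]mulrDl lerD//.
  rewrite !normcM !normc_real ger0_norm// (gtr0_norm g0).
  rewrite (@le_trans _ _ (normc (p%:C * l1 - l0) * g))//.
    by rewrite ler_piMl// mulr_ge0 ?normc_ge0// ltW.
  rewrite (le_trans (ler_wpM2r (ltW g0) hE))// -!mulrA ler_wpM2l//.
  have -> : expR (N - N * ln N) * g =
      (g * expR (N - (N - 2^-1) * ln N)) * expR (- (ln N / 2)).
    by rewrite -mulrA -expRD mulrC; congr (_ * expR _); field.
  by rewrite ler_wpM2r ?expR_ge0.
rewrite normcM !normc_real [X in _ * X]ger0_norm ?mulr_ge0 ?pi_ge0// mulrC.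
rewrite ler_wpM2l ?mulr_ge0 ?pi_ge0//.
have rN : `|r - 1| <= N^-1.
  rewrite ler_norml; apply/andP; split; last by rewrite (@le_trans _ _ 0) ?invr_ge0 ?(ltW N0)//; lra.
  have : 1 - N^-1 <= N / (N + 1).
    rewrite ler_pdivlMr; last lra.
    rewrite (_ : _ * _ = N - N^-1); last by field; rewrite gt_eqF.
    by rewrite gerBl invr_ge0 ltW.
  by move=> h; rewrite lerBrDl (le_trans h).
rewrite (le_trans rN)// -[N in N^-1]lnK ?posrE// -expRN ler_expR lerN2.
by have := ln_ge0 N1; lra.
Qed.

(** [a + 1] is an integer shift of a point of [1, 2]. Writing [a / Gamma (a + 1)] for [1 / Gamma a]
    includes [a = 0], which occurs as [1 - b] at order [b = 1]. *)
Lemma hankel_limitE a : 0 <= a -> L a = (2 * pi * (a / Gamma (a + 1)))%:C.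
Proof.
move=> a0; have PS b : 1 <= b -> L (b + 1) * (Gamma (b + 1))%:C = L b * (Gamma b)%:C.
  exact: hankel_limit_Gamma_shift.
have /andP[na an] := Num.Theory.truncn_itv a0.
set n := Num.truncn a in na an.
have x01 : 0 <= a - n%:R <= 1.
  by move: an; rewrite -natr1; lra.
have /andP[x0 _] := x01.
have := shift_invariant_nat PS n x0; rewrite (hankel_limit_Gamma01 x01).
have -> : n.+1%:R + (a - n%:R) = a + 1 :> R by rewrite -natr1; ring.
have a11 : 1 <= a + 1 by lra.
have := Gamma_gt0 a11; rewrite (hankel_limit_rec LP a0).
move: (Gamma (a + 1)) (L (a + 1)) => g l g0 lg.
have gC : g%:C != 0 by rewrite -normc_gt0 normc_real normr_gt0 gt_eqF.
apply: (mulIf gC); rewrite -[LHS]mulrA lg -!rmorphM/=; congr (_%:C).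
by field; rewrite gt_eqF.
Qed.

End hankel_value.

(** * Narrowing the arcs to an angle between pi / 2 and pi *)

Section hankel_theta.
Context {R : realType}.
Implicit Types (a c x y X Y theta : R) (w : R[i]).
Local Opaque Gamma.

Lemma arcint_diff_le (g : R[i] -> R[i]) theta Y k : 0 <= theta <= pi ->
  (forall y, cdiff (fun y => g (Y +i* y)) y) ->
  (forall y, theta <= `|y| <= pi -> normc (g (Y +i* y)) <= k) ->
  normc (arcint pi Y g - arcint theta Y g) <= 4 * (k * pi).
Proof.
move=> /andP[t0 tpi] dg gk.
have k0 : 0 <= k.
  by apply: le_trans (gk pi _); rewrite ?normc_ge0// ger0_norm ?pi_ge0// tpi lexx.
have tt : - theta <= theta by rewrite ge0_cp.
have pt : - pi <= - theta by rewrite lerN2.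
rewrite /arcint (@cint_split _ (- pi) (- theta) pi)//; last exact: le_trans tpi.
rewrite (@cint_split _ (- theta) theta pi)//.
rewrite [X in normc X](_ : _ = cint (- pi) (- theta) (fun y => g (Y +i* y)) +
  cint theta pi (fun y => g (Y +i* y))); last by ring.
rewrite (le_trans (normc_triangle _ _))//.
have -> : 4 * (k * pi) = 2 * (k * pi) + 2 * (k * pi) by ring.
rewrite lerD//.
  apply: le_trans (normc_cint_le_cst (k := k) pt _ _) _ => //.
    move=> y /andP[y1 y2]; apply: gk; rewrite -normrN ger0_norm; last by lra.
    by apply/andP; split; lra.
  by rewrite ler_wpM2l// ler_wpM2l//; lra.
apply: le_trans (normc_cint_le_cst (k := k) tpi _ _) _ => //.
  by move=> y /andP[y1 y2]; apply: gk; rewrite ger0_norm ?y1 ?y2// (le_trans t0).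
by rewrite ler_wpM2l// ler_wpM2l// gerBl.
Qed.

(** On the discarded part of the arc [cos y <= - c], so [exp s] decays exponentially in the radius
    and the limit is unchanged. [K] is uniform in [a], as summing over the terms of a series
    requires. *)
Lemma arc_hankelE theta c : 0 <= theta <= pi -> cos theta = - c -> 0 < c ->
  exists2 K, 0 <= K & forall a Y, 0 <= a -> 0 <= Y ->
    normc (arcint theta Y (hankel a) - (2 * pi * (a / Gamma (a + 1)))%:C) <=
    K * expR (- (a * Y)) * expR (- Y).
Proof.
move=> tpi tc c0; have [L LP] := @hankel_limit_exists R.
exists (8 + 4 * (2 / c ^+ 2 * pi)) => [|a Y a0 Y0].
  by rewrite addr_ge0// !mulr_ge0 ?invr_ge0 ?sqr_ge0 ?pi_ge0.
rewrite -(hankel_limitE LP a0).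
set P := arcint pi Y (hankel a); set A := arcint theta _ _.
have -> : A - L a = (P - L a) - (P - A) by ring.
rewrite (le_trans (normcB _ _))// -!mulrA mulrDl lerD//.
  rewrite (le_trans (LP a Y a0 Y0))// -mulrA ler_wpM2l// ler_wpM2l ?expR_ge0//.
  exact: expR_expR_le.
pose k := 2 / c ^+ 2 * (expR (- (a * Y)) * expR (- Y)).
rewrite (le_trans (@arcint_diff_le (hankel a) theta Y k tpi _ _))//.
- by move=> y; apply: cdiff_hankel; exact: cdiff_vline.
- move=> y /andP[ty ypi]; rewrite normc_hankel.
  have /andP[t0 tp] := tpi.
  have cy : cos y <= - c.
    rewrite -cos_norm -tc leNgt ltr_cos ?in_itv/= ?normr_ge0 ?ypi ?t0 ?tp//.
    by rewrite -leNgt.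
  have E0 := expR_gt0 Y.
  rewrite (@le_trans _ _ (expR (- (a * Y)) * (expR Y * expR (- (c * expR Y)))))//.
    rewrite -!expRD ler_expR.
    have : expR Y * cos y <= expR Y * (- c) by rewrite ler_wpM2l// ltW.
    lra.
  rewrite /k [leRHS]mulrCA; apply: ler_wpM2l; first exact: expR_ge0.
  rewrite !expRN ler_pdivrMr ?expR_gt0//.
  (* [exp u >= u^2 / 2] at [u = c exp Y] turns the doubly exponential decay into the rate
     [exp(- Y)]. *)
  have := @expR_ge1Dxn R (c * expR Y) 1; rewrite mulr_ge0 ?(ltW c0) ?(ltW E0)// => /(_ isT).
  rewrite (_ : 2`!%:R = 2 :> R)//.
  move: (expR Y) E0 => E E0 h.
  rewrite [leLHS](_ : E = 2 / c ^+ 2 / E * ((c * E) ^+ 2 / 2)); last first.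
    by field; rewrite !gt_eqF.
  by rewrite ler_wpM2l ?mulr_ge0 ?invr_ge0 ?sqr_ge0 ?(ltW E0)//; lra.
- by rewrite le_eqVlt; apply/orP; left; apply/eqP; rewrite /k; field; rewrite gt_eqF.
Qed.

End hankel_theta.

(** * Partial sums of the Mittag-Leffler series as arc integrals *)

Section mittag_leffler_contour.
Context {R : realType}.
Implicit Types (a b c x y X Y theta : R) (z w : R[i]).
Local Opaque Gamma.

Lemma limn_complex (s : nat -> R[i]) (l : R[i]) :
  (forall e : R, 0 < e -> exists N, forall n, (N <= n)%N -> normc (s n - l) < e) ->
  limn (s : nat -> R[i]^o) = l.
Proof.
move=> sl; apply/cvg_lim => //; apply/cvgrPdist_lt => e e0.
have [Ie Re0] : Im e = 0 /\ 0 < Re e.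
  by move: e0; rewrite ltcE/= => /andP[/eqP].
have [N NP] := sl _ Re0; exists N => // n /= Nn.
rewrite distrC normr_normc ltcE/= Ie eqxx/=; exact: NP.
Qed.

Lemma cdiffX (f : R -> R[i]) t n : cdiff f t -> cdiff (fun s => f s ^+ n) t.
Proof.
move=> df; elim: n => [|n IH].
  by under [X in cdiff X]funext do rewrite expr0; exact: cdiff_cst.
by under [X in cdiff X]funext do rewrite exprS; exact: cdiffM.
Qed.

Lemma realcV x : (x^-1)%:C = x%:C^-1 :> R[i].
Proof.
have [->|x0] := eqVneq x 0; first by rewrite !invr0.
have xC : x%:C != 0 by rewrite -normc_gt0 normc_real normr_gt0.
by apply: (mulIf xC); rewrite mulVf// -rmorphM/= mulVf.
Qed.

Definition ml_sum b z (n : nat) : R[i] :=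
  \sum_(k < n) z ^+ k / (Gamma (b * k%:R + 1))%:C.

Lemma mittag_lefflerE b z : mittag_leffler b z = limn (ml_sum b z : nat -> R[i]^o).
Proof.
rewrite /mittag_leffler (_ : series _ = ml_sum b z)//; apply/funext => n.
by rewrite /series/= big_mkord.
Qed.

(** A finite geometric sum in [z s^(- b)] with exact remainder; the term of index [k] is [z^k] times
    the Hankel integrand of [1 / Gamma (b k + 1)]. *)
Lemma wkernel_geometric b z w (n : nat) : cexp (b%:C * w) - z != 0 ->
  wkernel b b z w = \sum_(k < n) z ^+ k * hankel (b * k%:R + 1) w +
    (z * cexp (- (b%:C * w))) ^+ n * wkernel b b z w.
Proof.
move=> n0; rewrite /wkernel.
have -> : \sum_(k < n) z ^+ k * hankel (b * k%:R + 1) w =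
    cexp (cexp w) * \sum_(k < n) (z * cexp (- (b%:C * w))) ^+ k.
  rewrite big_distrr/=; apply: eq_bigr => k _.
  rewrite hankelE cexpD mulrCA; congr (_ * _); rewrite exprMn; congr (_ * _).
  rewrite -cexpX; congr cexp; rewrite opprD addrCA subrr addr0.
  by rewrite -[RHS]mulr_natl rmorphN rmorphM/= rmorph_nat; ring.
rewrite cexpN cexpD; set u := cexp (b%:C * w) in n0 *.
have u0 : u != 0 by exact: cexp_neq0.
have := subrX1 (z / u) n => h.
have nz : z / u - 1 != 0.
  by rewrite subr_eq0; apply: contra n0 => /eqP e; rewrite -[z](divfK u0) e mul1r subrr.
apply: (mulfI nz); rewrite [RHS]mulrDr [X in _ = X + _]mulrCA -h.
by field; rewrite n0 u0.
Qed.

Section fixed_parameters.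
Context (theta c b delta : R) (z : R[i]).
Context (tpi : 0 <= theta <= pi) (tc : cos theta = - c) (c0 : 0 < c).
Context (b0 : 0 < b) (d0 : 0 < delta).
Context (dP : forall x y, - theta <= y <= theta ->
  delta <= normc (cexp (b%:C * (x +i* y)) - z)).

Lemma wkernel_denominator x y : - theta <= y <= theta ->
  cexp (b%:C * (x +i* y)) - z != 0.
Proof. by move=> /(dP x) h; rewrite -normc_gt0 (lt_le_trans d0). Qed.

Lemma cdiff_wkernel e Y y : - theta <= y <= theta ->
  cdiff (fun y => wkernel e b z (Y +i* y)) y.
Proof.
move=> yt; apply: cder_cdiff (cder_wkernel _ _ (cder_vline _ _)).
exact: wkernel_denominator.
Qed.

Lemma cdiff_wkernel_hline e x y : - theta <= y <= theta ->
  cdiff (fun x => wkernel e b z (x +i* y)) x.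
Proof.
move=> yt; apply: cder_cdiff (cder_wkernel _ _ (cder_hline _ _)).
exact: wkernel_denominator.
Qed.

(** [Y] is fixed before [n], so large that the ratio of the geometric series is at most 1/2 on the
    arc. The errors of the Hankel integrals are then summable against [2^(- k)], uniformly in [n];
    [M] comes from the geometric remainder and may depend on [Y]. *)
Lemma ml_sum_arc : exists2 K, 0 <= K & forall Y, 0 <= Y ->
  normc z * expR (- (b * Y)) <= 2^-1 ->
  exists2 M, 0 <= M & forall n,
    normc (arcint theta Y (wkernel b b z) - (2 * pi)%:C * ml_sum b z n) <=
    K * expR (- Y) + M * 2^-1 ^+ n.
Proof.
have [K K0 KP] := arc_hankelE tpi tc c0.
have /andP[t0 tp] := tpi.
have tt : - theta <= theta by rewrite ge0_cp.
exists (K * 2); first by rewrite mulr_ge0.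
move=> Y Y0 zY.
pose M := expR (expR Y + b * Y) / delta.
have M0 : 0 <= M by rewrite divr_ge0 ?expR_ge0 ?(ltW d0).
exists (2 * (M * (theta - - theta))).
  by rewrite mulr_ge0// mulr_ge0// subr_ge0.
move=> n.
have dh k y : cdiff (fun y => z ^+ k * hankel (b * k%:R + 1) (Y +i* y)) y.
  apply: cdiffM; first exact: cdiff_cst.
  by apply: cdiff_hankel; exact: cdiff_vline.
have dr y : - theta <= y <= theta -> cdiff (fun y =>
    (z * cexp (- (b%:C * (Y +i* y)))) ^+ n * wkernel b b z (Y +i* y)) y.
  move=> yt; apply: cdiffM; last exact: cdiff_wkernel.
  apply: cdiffX; apply: cdiffM; first exact: cdiff_cst.
  apply: cdiff_cexp; under [X in cdiff X]funext do rewrite -mulNr.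
  by apply: cdiffM; [exact: cdiff_cst|exact: cdiff_vline].
have -> : arcint theta Y (wkernel b b z) =
    \sum_(k < n) z ^+ k * arcint theta Y (hankel (b * k%:R + 1)) +
    cint (- theta) theta (fun y =>
      (z * cexp (- (b%:C * (Y +i* y)))) ^+ n * wkernel b b z (Y +i* y)).
  rewrite [LHS]/arcint (@eq_cint _ _ _ _ (fun y =>
    \sum_(k < n) z ^+ k * hankel (b * k%:R + 1) (Y +i* y) +
    (z * cexp (- (b%:C * (Y +i* y)))) ^+ n * wkernel b b z (Y +i* y))); last first.
    by move=> y yt; apply: wkernel_geometric; exact: wkernel_denominator.
  rewrite cintD//; last by move=> y _; apply: cdiff_sum => k; exact: dh.
  congr (_ + _); rewrite cint_sum; last by move=> k y _; exact: dh.
  apply: eq_bigr => k _; rewrite cintZ// => y _.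
  by apply: cdiff_hankel; exact: cdiff_vline.
rewrite addrAC (le_trans (normc_triangle _ _))// lerD//.
  rewrite /ml_sum big_distrr/= -sumrB.
  have half : \sum_(k < n) 2^-1 ^+ k <= 2 :> R.
    have -> : \sum_(k < n) 2^-1 ^+ k = 2 * (1 - 2^-1 ^+ n) :> R.
      have := subrX1 (2^-1 : R) n; lra.
    by rewrite ler_piMr// gerBl exprn_ge0// invr_ge0.
  have term (k : 'I_n) : normc (z ^+ k * arcint theta Y (hankel (b * k%:R + 1)) -
      (2 * pi)%:C * (z ^+ k / (Gamma (b * k%:R + 1))%:C)) <=
      K * expR (- Y) * 2^-1 ^+ k.
    have a1 : 1 <= b * k%:R + 1 by rewrite lerDr mulr_ge0// ltW.
    have a0 : 0 <= b * k%:R + 1 by rewrite (le_trans ler01).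
    have := KP _ _ a0 Y0; rewrite (GammaS a1).
    have := Gamma_gt0 a1; move: (Gamma _) => g g0.
    move: (arcint _ _ _) => A; set a := b * k%:R + 1 in a1 a0 *.
    have -> : 2 * pi * (a / (a * g)) = 2 * pi / g.
      by field; rewrite !gt_eqF// (lt_le_trans ltr01).
    move=> h.
    have -> : z ^+ k * A - (2 * pi)%:C * (z ^+ k / g%:C) =
        z ^+ k * (A - (2 * pi / g)%:C).
      by rewrite !rmorphM /= realcV; ring.
    rewrite normcM normcX (le_trans (ler_wpM2l _ h)) ?exprn_ge0 ?normc_ge0//.
    have zk : normc z ^+ k * expR (- (b * Y)) ^+ k <= 2^-1 ^+ k.
      by rewrite -exprMn lerXn2r ?nnegrE ?mulr_ge0 ?normc_ge0 ?expR_ge0 ?invr_ge0.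
    have -> : expR (- (a * Y)) = expR (- (b * Y)) ^+ k * expR (- Y).
      by rewrite -expRM_natl -expRD /a; congr expR; ring.
    have e1 : expR (- Y) <= 1 by rewrite expR_le1 oppr_le0.
    have -> : normc z ^+ k * (K * (expR (- (b * Y)) ^+ k * expR (- Y)) * expR (- Y)) =
      K * expR (- Y) * (normc z ^+ k * expR (- (b * Y)) ^+ k * expR (- Y)) by ring.
    rewrite ler_wpM2l ?mulr_ge0 ?expR_ge0// (le_trans _ zk)// ler_piMr//.
    by rewrite mulr_ge0 ?exprn_ge0 ?normc_ge0 ?expR_ge0.
  have sumle : forall (F : 'I_n -> R[i]) (G : 'I_n -> R), (forall i, normc (F i) <= G i) ->
      normc (\sum_i F i) <= \sum_i G i.
    move=> F G FG; apply: (big_ind2 (fun (u : R[i]) (v : R) => normc u <= v)) => //.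
      by rewrite normc0.
    by move=> u1 v1 u2 v2 h1 h2; rewrite (le_trans (normc_triangle _ _))// lerD.
  rewrite (le_trans (sumle _ _ term))// -mulr_sumr [leRHS]mulrAC ler_wpM2l//.
  by rewrite mulr_ge0 ?expR_ge0.
apply: le_trans (normc_cint_le_cst (k := 2^-1 ^+ n * M) tt dr _) _.
  move=> y yt; rewrite normcM normcX ler_pM ?exprn_ge0 ?normc_ge0//.
    rewrite lerXn2r ?nnegrE ?normc_ge0 ?invr_ge0//.
    by rewrite normcM normc_cexp cReN cReM/= mul0r subr0.
  rewrite (le_trans (normc_wkernel _ d0 (dP Y yt)))//.
  rewrite /M ler_wpM2r ?invr_ge0 ?(ltW d0)// ler_expR lerD2r.
  by rewrite ler_piMr ?expR_ge0// cos_le1.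
by rewrite le_eqVlt; apply/orP; left; apply/eqP; ring.
Qed.

End fixed_parameters.

End mittag_leffler_contour.

(** * The contour formula for the Mittag-Leffler function and a uniform bound *)

Section contour_estimates.
Context {R : realType}.
Implicit Types (a c x y X Y theta : R) (z w : R[i]).
Local Opaque Gamma.

Lemma expRN_lt_inv u : 0 < u -> expR (- u) < u^-1 :> R.
Proof.
move=> u0; rewrite expRN ltf_pV2 ?posrE ?expR_gt0//.
by rewrite (lt_le_trans _ (expR_ge1Dx u))// ltrDr.
Qed.

Lemma expRN_expR_le c X : 0 < c -> expR (- (c * expR X)) <= c^-1 * expR (- X).
Proof.
move=> c0; rewrite (le_trans (ltW (expRN_lt_inv _)))// ?mulr_gt0 ?expR_gt0//.
by rewrite invfM expRN.
Qed.

Lemma mul_expRN_lt (K e Y : R) : 0 <= K -> 0 < e -> K / e <= Y -> K * expR (- Y) < e.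
Proof.
move=> K0 e0 KY; rewrite expRN ltr_pdivrMr ?expR_gt0// mulrC -ltr_pdivrMr//.
by rewrite (le_lt_trans KY)// (lt_le_trans _ (expR_ge1Dx Y))// ltrDr.
Qed.

Lemma mul_half_expn_lt (M e : R) : 0 <= M -> 0 < e ->
  exists N, forall n, (N <= n)%N -> M * 2^-1 ^+ n < e.
Proof.
move=> M0 e0; exists (Num.bound (M / e)) => n Nn.
rewrite exprVn ltr_pdivrMr ?exprn_gt0// mulrC -ltr_pdivrMr//.
rewrite (lt_le_trans (archi_boundP _)) ?divr_ge0 ?(ltW e0)//.
by rewrite -natrX ler_nat (leq_trans Nn)// ltnW// ltn_expl.
Qed.

(** The arcs converge to some [V] by decay along the rays, which forces the partial sums to converge
    to [V / (2 pi)]: [Y] is chosen first, then [n]. Convergence of the series is obtained together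
    with its value. *)
Lemma mittag_leffler_arc theta c b delta z : 0 <= theta <= pi ->
  cos theta = - c -> 0 < c -> 0 < b <= 1 -> 0 < delta ->
  (forall x y, - theta <= y <= theta ->
     delta <= normc (cexp (b%:C * (x +i* y)) - z)) ->
  exists K, forall Y, 0 <= Y ->
    normc (arcint theta Y (wkernel b b z) - (2 * pi)%:C * mittag_leffler b z) <=
    K * expR (- Y).
Proof.
move=> tpi tc c0 /andP[b0 b1] d0 dP.
have [K K0 KP] := ml_sum_arc tpi tc c0 b0 d0 dP.
have /andP[t0 tp] := tpi.
have tt : - theta <= theta by rewrite ge0_cp.
have thi : - theta <= theta <= theta by rewrite tt lexx.
have tlo : - theta <= - theta <= theta by rewrite tt lexx.
pose C := 2 * (2 / delta / c * c^-1).
have C0 : 0 <= C by rewrite !mulr_ge0 ?invr_ge0// ltW.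
have [V VP] : exists V, forall X, 0 <= X ->
    normc (arcint theta X (wkernel b b z) - V) <= 2 * (C * expR (- X)).
  apply: (@cauchy_bound_lim _ (fun X => arcint theta X (wkernel b b z))
    (fun X => C * expR (- X))) => X Y X0 XY.
  rewrite (wkernel_shift _ d0 t0 dP XY) normcM normcN normc_i mul1r.
  apply: le_trans (@tail_bound _ _ (2 / delta) c X Y _ c0 XY _ _) _.
  - by rewrite divr_ge0// ltW.
  - by move=> x _; apply: cdiffB; apply: cdiff_wkernel_hline d0 dP _ _ _ _.
  - move=> x /andP[Xx _]; rewrite (le_trans (normcB _ _))//.
    have bound y : cos y = - c -> - theta <= y <= theta ->
        normc (wkernel b b z (x +i* y)) <= delta^-1 * expR (x - c * expR x).
      move=> cy yt; rewrite (le_trans (normc_wkernel b d0 (dP x y yt)))//.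
      rewrite mulrC ler_wpM2l ?invr_ge0 ?(ltW d0)// ler_expR cy.
      have : b * x <= 1 * x by rewrite ler_wpM2r// (le_trans X0).
      lra.
    have -> : 2 / delta * expR (x - c * expR x) =
      delta^-1 * expR (x - c * expR x) + delta^-1 * expR (x - c * expR x) by ring.
    by rewrite lerD// bound// cosN.
  - rewrite /C -!mulrA ler_wpM2l// !mulrA -[leRHS]mulrA ler_wpM2l//.
      by rewrite !mulr_ge0 ?invr_ge0// ltW.
    exact: expRN_expR_le.
have p0 : 0 < 2 * pi :> R by rewrite mulr_gt0 ?pi_gt0.
have pC : (2 * pi)%:C != 0 :> R[i] by rewrite -normc_gt0 normc_real normr_gt0 gt_eqF.
suff -> : mittag_leffler b z = V / (2 * pi)%:C.
  by exists (2 * C) => Y Y0; rewrite mulrC divfK// -mulrA VP.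
rewrite mittag_lefflerE; apply: limn_complex => e e0.
have e20 : 0 < 2 * pi * e / 2 by rewrite divr_gt0// mulr_gt0.
have KC0 : 0 <= K + 2 * C by rewrite addr_ge0// mulr_ge0.
(* The first summand gives [exp(b Y) >= 1 + 2 |z|], hence a geometric ratio at most 1/2; the second
   keeps the errors in [exp(- Y)] below half of the tolerance. *)
pose Y := 2 * normc z / b + (K + 2 * C) / (2 * pi * e / 2).
have zb0 : 0 <= 2 * normc z / b by rewrite !mulr_ge0 ?invr_ge0 ?normc_ge0 ?(ltW b0).
have KE0 : 0 <= (K + 2 * C) / (2 * pi * e / 2) by rewrite divr_ge0// ltW.
have Y0 : 0 <= Y by rewrite addr_ge0.
have zY : normc z * expR (- (b * Y)) <= 2^-1.
  rewrite expRN ler_pdivrMr ?expR_gt0//.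
  have : b * (2 * normc z / b) <= b * Y by rewrite ler_wpM2l ?(ltW b0)// lerDl.
  rewrite (mulrC b) divfK ?gt_eqF//.
  have := expR_ge1Dx (b * Y); lra.
have [M M0 MP] := KP Y Y0 zY.
have [N NP] := mul_half_expn_lt M0 e20.
exists N => n /NP Mn.
have KY : (K + 2 * C) * expR (- Y) < 2 * pi * e / 2.
  by apply: mul_expRN_lt => //; rewrite lerDr.
rewrite -(ltr_pM2l p0) -{1}(gtr0_norm p0) -normc_real -normcM mulrBr.
rewrite [X in _ - X]mulrC divfK//.
set A := arcint theta Y (wkernel b b z) in MP.
have -> : (2 * pi)%:C * ml_sum b z n - V =
    (A - V) - (A - (2 * pi)%:C * ml_sum b z n) by ring.
apply: le_lt_trans (normcB _ _) _.
have h1 := MP n; have h2 : normc (A - V) <= _ := VP Y Y0.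
move: h1 h2; move: (normc _) (normc _) => u v h1 h2.
move: h1 h2 Mn KY; set p := 2 * pi * e; set q := expR _; set r := 2^-1 ^+ n; lra.
Qed.

(* [C] does not depend on [Y]: on the two horizontal sides [cos y < 0], so
   [expR (expR x * cos y)] decays doubly exponentially. *)
Lemma contour_bound theta c : 0 <= theta <= pi -> cos theta = - c -> 0 < c ->
  exists2 C, 0 <= C & forall (f : R[i] -> R[i]) (B Y : R), 0 <= B -> 0 <= Y ->
    (forall y, - theta <= y <= theta -> cdiff (fun y => f (0 +i* y)) y) ->
    (forall x, cdiff (fun x => f (x +i* theta)) x) ->
    (forall x, cdiff (fun x => f (x +i* (- theta))) x) ->
    (forall x y, 0 <= x -> - theta <= y <= theta ->
      normc (f (x +i* y)) <= B * expR (expR x * cos y + 4 * x)) ->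
    normc (arcint theta 0 f -
      'i%C * cint 0 Y (fun x => f (x +i* theta) - f (x +i* (- theta)))) <= C * B.
Proof.
move=> /andP[t0 tp] tc c0.
have tt : - theta <= theta by rewrite ge0_cp.
have thi : - theta <= theta <= theta by rewrite tt lexx.
have tlo : - theta <= - theta <= theta by rewrite tt lexx.
(* The constant of [exp(3 x) <= K exp((c / 2) exp x)], from the cubic term of the exponential
   series. Half of the decay absorbs [exp(3 x)]; the other half, with the remaining [exp x], has the
   shape asked for by [tail_bound]. *)
pose K := 3`!%:R * (2 / c) ^+ 3.
have K0 : 0 <= K by rewrite mulr_ge0// exprn_ge0// divr_ge0// ltW.
have h3 x : expR (3 * x) <= K * expR (c / 2 * expR x).
  have u0 : 0 <= c / 2 * expR x by rewrite !mulr_ge0 ?expR_ge0 ?invr_ge0 ?(ltW c0).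
  have := @expR_ge1Dxn R _ 2 u0 => h.
  have -> : expR (3 * x) = K * ((c / 2 * expR x) ^+ 3 / 3`!%:R).
    rewrite (expRM_natl 3) /K; set e := expR x.
    have f0 : 3`!%:R != 0 :> R by [].
    by field; rewrite f0 gt_eqF.
  by rewrite ler_wpM2l//; move: h; lra.
exists (2 * (expR 1 * (2 * pi)) + 2 * (2 * K / (c / 2))).
  by rewrite !addr_ge0// !mulr_ge0 ?expR_ge0 ?pi_ge0 ?invr_ge0 ?mulr_ge0 ?invr_ge0 ?(ltW c0).
move=> f B Y B0 Y0 df dfp dfm fB.
rewrite (le_trans (normcB _ _))// mulrDl lerD//.
  apply: le_trans (normc_cint_le_cst (k := B * expR 1) tt df _) _.
    move=> y yt; rewrite (le_trans (fB 0 y (lexx 0) yt))// ler_wpM2l// ler_expR.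
    by rewrite expR0 mul1r mulr0 addr0 cos_le1.
  have -> : 2 * (expR 1 * (2 * pi)) * B = 2 * (B * expR 1 * (2 * pi)) by ring.
  rewrite ler_wpM2l// ler_wpM2l ?mulr_ge0 ?expR_ge0 ?opprK //. lra.
rewrite normcM normc_i mul1r.
have K'0 : 0 <= 2 * (B * K) by apply: mulr_ge0 => //; exact: mulr_ge0.
have c20 : 0 < c / 2 by rewrite divr_gt0.
apply: le_trans (@tail_bound _ _ (2 * (B * K)) (c / 2) 0 Y K'0 c20 Y0 _ _) _.
- by move=> x _; apply: cdiffB.
- move=> x /andP[x0 _]; rewrite (le_trans (normcB _ _))//.
  have bound y : cos y = - c -> - theta <= y <= theta ->
      normc (f (x +i* y)) <= B * K * expR (x - c / 2 * expR x).
    move=> cy yt; rewrite (le_trans (fB x y x0 yt))// -mulrA ler_wpM2l// cy.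
    have -> : expR x * - c + 4 * x = 3 * x + (x - c * expR x) by ring.
    rewrite [leLHS]expRD (le_trans (ler_wpM2r (expR_ge0 _) (h3 x)))//.
    by rewrite -[leLHS]mulrA ler_wpM2l// -expRD ler_expR; lra.
  have -> : 2 * (B * K) * expR (x - c / 2 * expR x) =
    B * K * expR (x - c / 2 * expR x) + B * K * expR (x - c / 2 * expR x) by ring.
  by rewrite lerD// bound// cosN.
have -> : 2 * (2 * K / (c / 2)) * B = 2 * (2 * (B * K) / (c / 2) * 1).
  by field; rewrite gt_eqF.
rewrite ler_wpM2l//; apply: ler_wpM2l; first by rewrite divr_ge0 ?(ltW c20).
rewrite expR_le1 oppr_le0.
by rewrite mulr_ge0 ?expR_ge0// ltW.
Qed.

End contour_estimates.

(** * Size and Lipschitz bounds for the remainder *)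

Section remainder_estimates.
Context {R : realType}.
Implicit Types (a b c k l x y X Y theta : R) (z w u lam : R[i]).
Local Opaque Gamma.

(** If [|u| <= 3/2 |z|], the real parts differ by at least [k / 4 |z|]; otherwise the moduli differ
    by at least [|z| / 2]. *)
Lemma sector_dist k u z : 0 < k <= 1 -> - (k / 2) * normc u <= Re u ->
  Re z = - k * normc z -> k / 4 * normc z <= normc (u - z).
Proof.
move=> /andP[k0 k1] hu hz.
have h1 : Re u - Re z <= normc (u - z).
  by rewrite -cReN -cReD (le_trans (ler_norm _))// Re_le_normc.
have h2 := normc_distl u z.
have := normc_ge0 z; have := normc_ge0 u.
move: (normc u) (normc z) (normc (u - z)) hu hz h1 h2 => nu nz d hu hz h1 h2 nu0 nz0.
have kz : k * nz <= 1 * nz by rewrite ler_wpM2r.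
have [s|s] := leP nu (3 / 2 * nz).
  have : k / 2 * nu <= k / 2 * (3 / 2 * nz) by rewrite ler_wpM2l// divr_ge0// ltW.
  lra.
lra.
Qed.

Lemma normc_real_pos x : 0 <= x -> normc x%:C = x.
Proof. by move=> x0; rewrite normc_real ger0_norm. Qed.

Lemma realcB x y : (x - y)%:C = x%:C - y%:C :> R[i].
Proof. by rewrite rmorphB. Qed.

Section fixed_eigenvalue.
Context (lam : R[i]) (k theta b0 : R).
Context (lam0 : 0 < normc lam) (k01 : 0 < k <= 1).
Context (lamk : Re lam = - k * normc lam).
Context (tpi : 0 <= theta <= pi) (tc : cos theta = - (k / 2)) (b00 : 0 < b0).

(* With [l = ln t], this is [lam * t ^ b]. *)
Definition zval l b : R[i] := lam * (expR (b * l))%:C.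

Lemma normc_zval l b : normc (zval l b) = normc lam * expR (b * l).
Proof. by rewrite normcM normc_real_pos// expR_ge0. Qed.

(** The cosine of [theta] is half of that of the argument of [lam]. For [0 <= b <= 1] the point
    [s^b] has argument [b y] in [[- theta, theta]], so [sector_dist] applies. *)
Lemma zval_denominator l b x y : 0 <= b <= 1 -> - theta <= y <= theta ->
  k / 4 * (normc lam * expR (b * l)) <= normc (cexp (b%:C * (x +i* y)) - zval l b).
Proof.
move=> /andP[bge ble] yt; rewrite -normc_zval; apply: sector_dist => //.
  rewrite normc_cexp cReM/= ?(mul0r, addr0, subr0) [leRHS]mulrC ler_wpM2r ?expR_ge0//.
  have /andP[t0 tp] := tpi.
  have byt : `|b * y| <= theta.
    by rewrite normrM (ger0_norm bge) -[leRHS]mul1r ler_pM// ler_norml.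
  rewrite -tc -[leRHS]cos_norm leNgt ltr_cos ?in_itv/= ?normr_ge0 ?t0//=.
    by rewrite -leNgt.
  by rewrite (le_trans byt).
by rewrite normc_zval cReM/= mulr0 subr0 lamk mulrA.
Qed.

(* [z * wkernel b b z = remainder - hankel (1 - b)] for [z = zval l b]: the
   remainder is what is left of the contour integral of [z * E_b(z)] after
   its leading term [- 1 / Gamma (1 - b)]. *)
Definition remainder l b : R[i] -> R[i] := wkernel (2 * b) b (zval l b).

Lemma remainder_denominator_gt0 l b : 0 < k / 4 * (normc lam * expR (b * l)).
Proof. by rewrite !mulr_gt0 ?expR_gt0 ?invr_gt0//; case/andP: k01. Qed.

Lemma remainder_le l b x y : 0 <= l -> b0 <= b <= 1 -> 0 <= x ->
  - theta <= y <= theta ->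
  normc (remainder l b (x +i* y)) <=
  (k / 4 * normc lam)^-1 * expR (- (b0 * l)) * expR (expR x * cos y + 4 * x).
Proof.
move=> l0 /andP[b0b b1] x0 yt.
have b01 : 0 <= b <= 1 by rewrite b1 (le_trans _ b0b)// ltW.
rewrite (le_trans (normc_wkernel _ (remainder_denominator_gt0 l b)
  (zval_denominator l x b01 yt)))//.
rewrite mulrA invfM -expRN mulrC ler_pM ?expR_ge0//.
- by rewrite mulr_ge0 ?expR_ge0// invr_ge0 mulr_ge0 ?normc_ge0// divr_ge0// ltW//; case/andP: k01.
- rewrite ler_wpM2l ?invr_ge0 ?mulr_ge0 ?normc_ge0 ?divr_ge0//.
    by rewrite ltW//; case/andP: k01.
  by rewrite ler_expR lerN2 ler_wpM2r.
- rewrite ler_expR lerD2l.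
  have : b * x <= 1 * x by rewrite ler_wpM2r.
  lra.
Qed.

(** The numerator of the difference of [a^2 / (a - z)] at two orders: [a1], [a2] are the powers
    [s^b], [e = |s|], [W = |log s|], [n = |lam|], [s1], [s2] the powers [t^b], and [l = ln t]. Every
    term carries a factor [b2 - b1] and at most one power of [t]. *)
Lemma remainder_numerator_le (b1 b2 e W n s1 s2 l : R) (a1 a2 z1 z2 : R[i]) :
  b1 <= b2 -> 1 <= e -> 0 <= W -> W <= 5 * e -> 0 <= n -> 0 <= l ->
  0 <= s1 -> 0 <= s2 ->
  normc a1 <= e -> normc a2 <= e ->
  normc (a1 - a2) <= 2 * ((b2 - b1) * W * e) ->
  normc z1 = n * s1 -> normc (z1 - z2) <= n * ((b2 - b1) * l * s2) ->
  normc (a1 * a2 * (a1 - a2) + z1 * (a2 ^+ 2 - a1 ^+ 2) + a1 ^+ 2 * (z1 - z2)) <=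
  (b2 - b1) * e ^+ 4 * (10 + 20 * n * s1 + n * l * s2).
Proof.
move=> b12 e1 W0 We n0 l0 s10 s20 ha1 ha2 ha hz1 hz.
have e0 : 0 <= e by rewrite (le_trans ler01).
have D0 : 0 <= b2 - b1 by rewrite subr_ge0.
have ha' : normc (a1 - a2) <= (b2 - b1) * (10 * e ^+ 2).
  rewrite (le_trans ha)//.
  have : (b2 - b1) * e * W <= (b2 - b1) * e * (5 * e) by rewrite ler_wpM2l// mulr_ge0.
  lra.
have h1 : normc (a1 * a2 * (a1 - a2)) <= e * e * ((b2 - b1) * (10 * e ^+ 2)).
  by rewrite !normcM !ler_pM ?mulr_ge0 ?normc_ge0.
have h2 : normc (z1 * (a2 ^+ 2 - a1 ^+ 2)) <= n * s1 * ((b2 - b1) * (10 * e ^+ 2) * (e + e)).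
  rewrite subr_sqr normcM hz1 ler_wpM2l ?mulr_ge0// normcM ler_pM ?normc_ge0//.
    by rewrite -normcN opprB.
  by rewrite (le_trans (normc_triangle _ _))// lerD.
have h3 : normc (a1 ^+ 2 * (z1 - z2)) <= e ^+ 2 * (n * ((b2 - b1) * l * s2)).
  by rewrite normcM normcX ler_pM ?exprn_ge0 ?normc_ge0// lerXn2r ?nnegrE ?normc_ge0.
rewrite (le_trans (normc_triangle _ _))//.
rewrite (@le_trans _ _ (e * e * ((b2 - b1) * (10 * e ^+ 2)) +
  n * s1 * ((b2 - b1) * (10 * e ^+ 2) * (e + e)) +
  e ^+ 2 * (n * ((b2 - b1) * l * s2))))//.
  by rewrite lerD// (le_trans (normc_triangle _ _))// lerD.
have e2 : e ^+ 2 <= e ^+ 4 by rewrite ler_weXn2l.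
have e3 : e ^+ 3 <= e ^+ 4 by rewrite ler_weXn2l.
have k1 : (b2 - b1) * (n * s1) * e ^+ 3 <= (b2 - b1) * (n * s1) * e ^+ 4.
  by rewrite ler_wpM2l// !mulr_ge0.
have k2 : (b2 - b1) * (n * l * s2) * e ^+ 2 <= (b2 - b1) * (n * l * s2) * e ^+ 4.
  by rewrite ler_wpM2l// !mulr_ge0.
have -> : e * e * ((b2 - b1) * (10 * e ^+ 2)) +
  n * s1 * ((b2 - b1) * (10 * e ^+ 2) * (e + e)) +
  e ^+ 2 * (n * ((b2 - b1) * l * s2)) = 10 * (b2 - b1) * e ^+ 4 +
  20 * ((b2 - b1) * (n * s1) * e ^+ 3) + (b2 - b1) * (n * l * s2) * e ^+ 2 by ring.
have -> : (b2 - b1) * e ^+ 4 * (10 + 20 * n * s1 + n * l * s2) =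
  10 * (b2 - b1) * e ^+ 4 +
  20 * ((b2 - b1) * (n * s1) * e ^+ 4) + (b2 - b1) * (n * l * s2) * e ^+ 4 by ring.
by rewrite lerD// lerD// ler_wpM2l.
Qed.

(** The denominator contains both [s1] and [s2], each numerator term at most one of them: a factor
    [1 / s0], that is [t^(- b0)], is gained, up to the [1 + ln t] that comes from varying the
    exponent in [t^b]. *)
Lemma remainder_ratio_le (n s0 s1 s2 l kap : R) : 0 < n -> 0 <= l -> 0 < kap ->
  1 <= s0 -> s0 <= s1 -> s0 <= s2 ->
  (10 + 20 * n * s1 + n * l * s2) / (kap * (n * s1) * (kap * (n * s2))) <=
  (10 + 20 * n) / (kap * n) ^+ 2 * (1 + l) * s0^-1.
Proof.
move=> n0 l0 kap0 s01 h1 h2.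
have s1p : 0 < s1 by lra.
have s2p : 0 < s2 by lra.
have s0p : 0 < s0 by lra.
have -> : (10 + 20 * n) / (kap * n) ^+ 2 * (1 + l) * s0^-1 =
  ((10 + 20 * n) * (1 + l) * (s1 * s2) / s0) / (kap * (n * s1) * (kap * (n * s2))).
  by field; rewrite !gt_eqF.
rewrite ler_wpM2r ?invr_ge0 ?mulr_ge0 ?(ltW kap0) ?(ltW n0) ?(ltW s1p) ?(ltW s2p)//.
rewrite ler_pdivlMr//.
have m1 : s0 <= s1 * s2.
  by rewrite (le_trans h2)// ler_peMl ?(ltW s2p)// (le_trans s01).
have m2 : s1 * s0 <= s1 * s2 by rewrite ler_wpM2l// ltW.
have m3 : s2 * s0 <= s1 * s2 by rewrite mulrC ler_wpM2r// ltW.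
have m4 : n * (s1 * s0) <= n * (s1 * s2) by rewrite ler_wpM2l// ltW.
have m5 : (n * l) * (s2 * s0) <= (n * l) * (s1 * s2).
  by rewrite ler_wpM2l// mulr_ge0// ltW.
have m6 : 0 <= l * (s1 * s2) by rewrite !mulr_ge0// ltW.
have m7 : 0 <= (n * l) * (s1 * s2) by rewrite !mulr_ge0// ltW.
lra.
Qed.

(** The constant of [remainder_ratio_le] at [kap = k / 4]. It is free of [t] and of the orders, so a
    threshold can be fixed in advance. *)
Definition remainder_lip : R := (10 + 20 * normc lam) / (k / 4 * normc lam) ^+ 2.

Lemma remainder_lip_le l b1 b2 x y : 0 <= l -> b0 <= b1 -> b1 <= b2 -> b2 <= 1 ->
  0 <= x -> - theta <= y <= theta ->
  normc (remainder l b1 (x +i* y) - remainder l b2 (x +i* y)) <=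
  (b2 - b1) * (remainder_lip * (1 + l) * expR (- (b0 * l))) *
  expR (expR x * cos y + 4 * x).
Proof.
move=> l0 b01 b12 b21 x0 yt.
have b10 : 0 <= b1 <= 1 by rewrite (le_trans (ltW b00))// (le_trans b12).
have b20 : 0 <= b2 <= 1 by rewrite b21 (le_trans _ b12)//; case/andP: b10.
have dn1 := zval_denominator l x b10 yt.
have dn2 := zval_denominator l x b20 yt.
have d1 := remainder_denominator_gt0 l b1.
have d2 := remainder_denominator_gt0 l b2.
set w := x +i* y in dn1 dn2 *; set z1 := zval l b1 in dn1 *; set z2 := zval l b2 in dn2 *.
have n1 : cexp (b1%:C * w) - z1 != 0 by rewrite -normc_gt0 (lt_le_trans d1).
have n2 : cexp (b2%:C * w) - z2 != 0 by rewrite -normc_gt0 (lt_le_trans d2).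
set a1 := cexp (b1%:C * w) in n1 dn1; set a2 := cexp (b2%:C * w) in n2 dn2.
have qE b : cexp (cexp w + (2 * b)%:C * w) = cexp (cexp w) * cexp (b%:C * w) ^+ 2.
  by rewrite cexpD -cexpX rmorphM/= rmorph_nat -mulrA mulr_natl.
have -> : remainder l b1 w - remainder l b2 w = cexp (cexp w) *
    ((a1 * a2 * (a1 - a2) + z1 * (a2 ^+ 2 - a1 ^+ 2) + a1 ^+ 2 * (z1 - z2)) /
     ((a1 - z1) * (a2 - z2))).
  rewrite /remainder /wkernel !qE -/a1 -/a2 -/z1 -/z2.
  by field; rewrite n1 n2.
rewrite normcM normc_cexp /=.
have e1 : 1 <= expR x by rewrite -expR0 ler_expR.
have anorm b : 0 <= b <= 1 -> normc (cexp (b%:C * w)) <= expR x.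
  move=> /andP[bge ble]; rewrite normc_cexp cReM/= mul0r subr0 ler_expR.
  by rewrite ler_piMl.
have W5 : normc w <= 5 * expR x.
  rewrite (le_trans (normc_le_ReIm _))//= (ger0_norm x0).
  have yp : `|y| <= pi by rewrite (@le_trans _ _ theta) ?ler_norml//; case/andP: tpi.
  have := @pihalf_lt2 R; have := expR_ge1Dx x; lra.
have D0 : 0 <= b2 - b1 by rewrite subr_ge0.
have l12 : b1 * l <= b2 * l by rewrite ler_wpM2r.
have num := @remainder_numerator_le b1 b2 (expR x) (normc w) (normc lam)
  (expR (b1 * l)) (expR (b2 * l)) l a1 a2 z1 z2 b12 e1 (normc_ge0 _) W5 (normc_ge0 _) l0
  (expR_ge0 _) (expR_ge0 _) (anorm _ b10) (anorm _ b20).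
have {num} := num _ (normc_zval _ _) _.
rewrite normcM normcV normcM.
set N := _ + _ + a1 ^+ 2 * _ => num.
have {}num : normc N <= (b2 - b1) * expR x ^+ 4 *
  (10 + 20 * normc lam * expR (b1 * l) + normc lam * l * expR (b2 * l)).
  apply: num.
    have xb b : 0 <= b <= 1 -> Re (b%:C * w) <= x.
      by move=> /andP[bge ble]; rewrite cReM/= mul0r subr0 ler_piMl.
    rewrite (le_trans (normc_cexpB_le (xb _ b10) (xb _ b20)))// ler_wpM2l//.
    rewrite ler_wpM2r ?expR_ge0// -mulrBl normcM -realcB normc_real distrC.
    by rewrite ger0_norm.
  rewrite /z1 /z2 /zval -mulrBr normcM ler_wpM2l ?normc_ge0// -realcB.
  rewrite normc_real distrC ger0_norm ?subr_ge0 ?ler_expR//.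
  have -> : expR (b1 * l) = expR (b2 * l) * expR (- ((b2 - b1) * l)).
    by rewrite -expRD; congr expR; ring.
  have := expR_ge1Dx (- ((b2 - b1) * l)) => h.
  have : expR (b2 * l) * (1 - (b2 - b1) * l) <= expR (b2 * l) * expR (- ((b2 - b1) * l)).
    by rewrite ler_wpM2l ?expR_ge0.
  lra.
have kap0 : 0 < k / 4 by rewrite divr_gt0//; case/andP: k01.
have s01 : 1 <= expR (b0 * l) by rewrite -expR0 ler_expR mulr_ge0// ltW.
have s0s1 : expR (b0 * l) <= expR (b1 * l) by rewrite ler_expR ler_wpM2r.
have s0s2 : expR (b0 * l) <= expR (b2 * l) by rewrite ler_expR ler_wpM2r// (le_trans b01).
have ratio := remainder_ratio_le lam0 l0 kap0 s01 s0s1 s0s2.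
rewrite expRD (expRM_natl 4) mulrA mulrCA -mulrA ler_wpM2l ?expR_ge0//.
have den : (normc (a1 - z1) * normc (a2 - z2))^-1 <=
    (k / 4 * (normc lam * expR (b1 * l)) * (k / 4 * (normc lam * expR (b2 * l))))^-1.
  have p1 := lt_le_trans d1 dn1; have p2 := lt_le_trans d2 dn2.
  by rewrite lef_pV2 ?posrE ?(mulr_gt0 p1 p2) ?(mulr_gt0 d1 d2)// ler_pM// ltW.
rewrite (le_trans (ler_pM (normc_ge0 _) _ num den))//.
  by rewrite invr_ge0 mulr_ge0 ?normc_ge0.
have P0 : 0 <= (b2 - b1) * expR x ^+ 4 by rewrite mulr_ge0// exprn_ge0// expR_ge0.
have := ler_wpM2l P0 ratio; rewrite -expRN -/remainder_lip mulrA => h.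
apply: le_trans (le_trans _ h) _; rewrite le_eqVlt; apply/orP; left; apply/eqP; ring.
Qed.

End fixed_eigenvalue.
End remainder_estimates.

(** * Injectivity in the order for large times *)

Section injectivity.
Context {R : realType}.
Local Opaque Gamma mittag_leffler.

Lemma le_of_expRN_error (a b K : R) :
  (forall Y, 0 <= Y -> a <= b + K * expR (- Y)) -> a <= b.
Proof.
move=> h; apply/ler_addgt0Pr => e e0.
have Y0 : 0 <= `|K| / e by rewrite divr_ge0// ltW.
rewrite (le_trans (h _ Y0))// lerD2l.
rewrite (@le_trans _ _ (`|K| * expR (- (`|K| / e))))//.
  by rewrite ler_wpM2r ?expR_ge0// ler_norm.
by rewrite ltW// mul_expRN_lt.
Qed.

Lemma mittag_leffler_injective (lam : R[i]) (beta0 : R) :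
  Re lam < 0 -> 0 < beta0 -> exists2 T0, 1 < T0 & forall t, T0 < t ->
  forall b1 b2, beta0 <= b1 <= 1 -> beta0 <= b2 <= 1 ->
  mittag_leffler b1 (lam * (t `^ b1)%:C) = mittag_leffler b2 (lam * (t `^ b2)%:C) ->
  b1 = b2.
Proof.
move=> lamneg b00.
have lamn0 : lam != 0 by apply: contraTneq lamneg => ->; rewrite ltxx.
have n0 : 0 < normc lam by rewrite normc_gt0.
have [k k01 lamk] : exists2 k, 0 < k <= 1 & Re lam = - k * normc lam.
  exists (- Re lam / normc lam); last by rewrite mulNr divfK ?opprK// gt_eqF.
  rewrite divr_gt0 ?oppr_gt0//= ler_pdivrMr// mul1r (le_trans (ler_norm _))// normrN.
  exact: Re_le_normc.
have /andP[k0 k1] := k01.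
have [c cE] : exists c, c = k / 2 by exists (k / 2).
have c0 : 0 < c by rewrite cE divr_gt0.
have [theta tpi tc] : exists2 theta : R, 0 <= theta <= pi & cos theta = - c.
  have cI : -1 <= - c <= 1 by rewrite cE; lra.
  exists (acos (- c)); first by rewrite acos_ge0// acos_lepi.
  by rewrite acosK// in_itv.
have tck : cos theta = - (k / 2) by rewrite -cE.
have /andP[t0 tp] := tpi.
have tt : - theta <= theta by rewrite ge0_cp.
have thi : - theta <= theta <= theta by rewrite tt lexx.
have tlo : - theta <= - theta <= theta by rewrite tt lexx.
have [C C0 CP] := contour_bound tpi tc c0.
have [KH KH0 KHP] := arc_hankelE tpi tc c0.
pose A1 := (k / 4 * normc lam)^-1.
have A10 : 0 <= A1 by rewrite invr_ge0 mulr_ge0 ?divr_ge0 ?(ltW k0) ?(ltW n0).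
pose A2 := remainder_lip lam k.
have A20 : 0 <= A2.
  by rewrite mulr_ge0 ?addr_ge0 ?mulr_ge0 ?invr_ge0 ?exprn_ge0 ?mulr_ge0 ?invr_ge0 ?(ltW k0) ?(ltW n0).
(* Half of the decay [t^(- beta0)] pays for [1 + ln t], at the price of the factor [1 + 2 / beta0];
   the other half beats [D] once [ln t >= 2 D / beta0]. The 1 in the exponent of the threshold makes
   it exceed 1. *)
pose D := C * (A1 + A2) * (1 + 2 / beta0).
have D0 : 0 <= D by rewrite mulr_ge0 ?addr_ge0 ?divr_ge0 ?(ltW b00)// mulr_ge0// addr_ge0.
exists (expR (1 + 2 / beta0 * D)).
  by rewrite -[ltLHS]expR0 ltr_expR ltr_pwDl// mulr_ge0// divr_ge0// ltW.
move=> t Tt.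
have tp0 : 0 < t by rewrite (lt_trans _ Tt)// expR_gt0.
pose l := ln t.
have lD : 2 / beta0 * D <= l.
  rewrite -ler_expR lnK ?posrE// (le_trans _ (ltW Tt))// ler_expR; lra.
have l0 : 0 <= l by rewrite (le_trans _ lD)// mulr_ge0// divr_ge0// ltW.
have tE b : lam * (t `^ b)%:C = zval lam l b by rewrite gt0_powRE.
suff main b1 b2 : beta0 <= b1 -> b1 < b2 -> b2 <= 1 ->
    mittag_leffler b1 (zval lam l b1) = mittag_leffler b2 (zval lam l b2) -> False.
  move=> b1 b2 /andP[b11 b12] /andP[b21 b22]; rewrite !tE => e.
  case: (ltgtP b1 b2) => h.
  - exact: (False_ind _ (main b1 b2 b11 h b22 e)).
  - exact: (False_ind _ (main b2 b1 b21 h b12 (esym e))).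
  - exact: h.
move=> b01 b12 b21.
(* The contour formula for [z E_b(z) + 1 / Gamma (1 - b)], in the form that remains meaningful at
   [b = 1], cut off with error [O(exp(- Y))]. *)
have err b : beta0 <= b -> b <= 1 -> exists K, forall Y, 0 <= Y ->
    normc (arcint theta Y (remainder lam l b) - (2 * pi)%:C *
      (zval lam l b * mittag_leffler b (zval lam l b) +
        ((1 - b) / Gamma (1 + (1 - b)))%:C)) <= K * expR (- Y).
  move=> b0b ble1.
  have bp : 0 < b by rewrite (lt_le_trans b00).
  have b01' : 0 <= b <= 1 by rewrite ltW.
  have d0 := remainder_denominator_gt0 n0 k01 l b.
  have dP x y (yt : - theta <= y <= theta) :=
    zval_denominator k01 lamk tpi tck l x b01' yt.
  have bp1 : 0 < b <= 1 by rewrite bp.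
  have [K KP] := mittag_leffler_arc tpi tc c0 bp1 d0 dP.
  exists (normc (zval lam l b) * K + KH) => Y Y0.
  have a0 : 0 <= 1 - b by rewrite subr_ge0.
  have hY := KHP _ _ a0 Y0; have gY := KP _ Y0.
  move: hY gY; rewrite (addrC 1 (1 - b)).
  move: (Gamma _) (mittag_leffler _ _) => g E hY gY.
  have split : arcint theta Y (remainder lam l b) =
      zval lam l b * arcint theta Y (wkernel b b (zval lam l b)) +
      arcint theta Y (hankel (1 - b)).
    rewrite /arcint -cintZ; last by move=> y yt; exact: cdiff_wkernel d0 dP _ _ _ yt.
    rewrite -cintD; last 2 first.
    - move=> y yt; apply: cdiffM; first exact: cdiff_cst.
      exact: cdiff_wkernel d0 dP _ _ _ yt.
    - by move=> y _; apply: cdiff_hankel; exact: cdiff_vline.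
    apply: eq_cint => y yt; have := wkernel_denominator d0 dP Y yt.
    rewrite hankelE /remainder /wkernel opprB addrCA subrr addr0.
    rewrite rmorphM/= rmorph_nat -mulrA mulr_natl mulr2n addrA !cexpD.
    move: (cexp _) (cexp _) (zval _ _ _) => u v z uz.
    by field.
  rewrite split; move: hY gY; clear - KH0 a0 Y0.
  move: (arcint _ _ (hankel _)) (arcint _ _ (wkernel _ _ _)) => H A hY gY.
  have -> : zval lam l b * A + H - (2 * pi)%:C * (zval lam l b * E + ((1 - b) / g)%:C) =
    zval lam l b * (A - (2 * pi)%:C * E) + (H - (2 * pi * ((1 - b) / g))%:C).
    by rewrite [(2 * pi * _)%:C]rmorphM/=; ring.
  rewrite (le_trans (normc_triangle _ _))// [leRHS]mulrDl lerD//.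
    by rewrite normcM -mulrA ler_wpM2l ?normc_ge0.
  rewrite (le_trans hY)// -mulrA ler_wpM2l// ler_piMl ?expR_ge0//.
  by rewrite expR_le1 oppr_le0 mulr_ge0.
have b02 : beta0 <= b2 by rewrite (le_trans b01)// ltW.
have b11 : b1 <= 1 by rewrite (le_trans (ltW b12)).
have [K1 err1] := err _ b01 b11.
have [K2 err2] := err _ b02 b21.
have x20 : 0 <= 1 - b2 by rewrite subr_ge0.
have x12 : 1 - b2 < 1 - b1 by rewrite ltrD2l ltrN2.
have x11 : 1 - b1 <= 1 by rewrite gerBl (le_trans (ltW b00)).
have slope := inv_Gamma_slope x20 x12 x11.
have H20 : 0 <= (1 - b2) / Gamma (1 + (1 - b2)).
  by rewrite divr_ge0// ltW// Gamma_gt0// lerDl.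
pose G b w := remainder lam l b w.
have dGv b : 0 <= b <= 1 -> forall y, - theta <= y <= theta ->
    cdiff (fun y => G b (0 +i* y)) y.
  move=> b01' y yt; apply: (cdiff_wkernel (remainder_denominator_gt0 n0 k01 l b)) yt.
  by move=> x v; exact: zval_denominator.
have dGh b y : 0 <= b <= 1 -> - theta <= y <= theta -> forall x,
    cdiff (fun x => G b (x +i* y)) x.
  move=> b01' yt x; apply: (cdiff_wkernel_hline (remainder_denominator_gt0 n0 k01 l b)) yt.
  by move=> v u; exact: zval_denominator.
have arcE b Y : 0 <= b <= 1 -> 0 <= Y -> arcint theta Y (remainder lam l b) =
    arcint theta 0 (G b) -
    'i%C * cint 0 Y (fun x => G b (x +i* theta) - G b (x +i* (- theta))).
  move=> b01' Y0; rewrite -mulNr.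
  rewrite -(wkernel_shift _ (remainder_denominator_gt0 n0 k01 l b) t0 _ Y0).
    by rewrite subrKC.
  by move=> x v; exact: zval_denominator.
have b10 : 0 <= b1 <= 1 by rewrite (le_trans (ltW b00)).
have b20 : 0 <= b2 <= 1 by rewrite (le_trans (ltW b00)).
pose e0 := expR (- (beta0 * l)).
have bound2 Y : 0 <= Y -> normc (arcint theta Y (remainder lam l b2)) <= C * (A1 * e0).
  move=> Y0; rewrite (arcE _ _ b20 Y0); apply: CP => //.
  - by rewrite mulr_ge0// expR_ge0.
  - exact: dGv.
  - exact: dGh.
  - exact: dGh.
  - have bb : beta0 <= b2 <= 1 by rewrite b02.
    by move=> x y x0 yt; exact: (remainder_le n0 k01 lamk tpi tck b00 l0 bb x0 yt).
(* The difference of the two contour integrals is regrouped as one contour integral of the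
   difference, to which [contour_bound] applies with the Lipschitz estimate. *)
have bound12 Y : 0 <= Y -> normc (arcint theta Y (remainder lam l b1) -
    arcint theta Y (remainder lam l b2)) <= C * ((b2 - b1) * (A2 * (1 + l) * e0)).
  move=> Y0; rewrite (arcE _ _ b10 Y0) (arcE _ _ b20 Y0).
  pose lines b x := G b (x +i* theta) - G b (x +i* (- theta)).
  have dl b (x : R) : 0 <= b <= 1 -> cdiff (lines b) x.
    by move=> bb; apply: cdiffB; exact: dGh.
  have cB := cintB (fun x (_ : 0 <= x <= Y) => dl b1 x b10) (fun x _ => dl b2 x b20).
  have -> : arcint theta 0 (G b1) - 'i%C * cint 0 Y (lines b1) -
      (arcint theta 0 (G b2) - 'i%C * cint 0 Y (lines b2)) =
    arcint theta 0 (fun w => G b1 w - G b2 w) -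
      'i%C * cint 0 Y (fun x => (G b1 (x +i* theta) - G b2 (x +i* theta)) -
        (G b1 (x +i* (- theta)) - G b2 (x +i* (- theta)))).
    have -> : cint 0 Y (fun x => (G b1 (x +i* theta) - G b2 (x +i* theta)) -
        (G b1 (x +i* (- theta)) - G b2 (x +i* (- theta)))) =
        cint 0 Y (fun x => lines b1 x - lines b2 x).
      by apply: eq_cint => x _; rewrite /lines; ring.
    rewrite cB /arcint (cintB (dGv _ b10) (dGv _ b20)).
    move: (cint _ _ _) (cint _ _ _) (cint _ _ _) (cint _ _ _) => c1 c2 c3 c4.
    by ring.
  apply: CP => //.
  - apply: mulr_ge0; first by rewrite subr_ge0 ltW.
    apply: mulr_ge0; last exact: expR_ge0.
    by apply: mulr_ge0 => //; rewrite addr_ge0.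
  - by move=> y yt; apply: cdiffB; [exact: dGv b10 _ yt|exact: dGv b20 _ yt].
  - by move=> x; apply: cdiffB; exact: dGh.
  - by move=> x; apply: cdiffB; exact: dGh.
  - move=> x y x0 yt.
    exact: (remainder_lip_le n0 k01 lamk tpi tck b00 l0 b01 (ltW b12) b21 x0 yt).
(* The ratio of the two arguments, through which both identities are expressed with the same [z]. *)
pose r := expR (- ((b2 - b1) * l)).
have Dl0 : 0 <= (b2 - b1) * l by rewrite mulr_ge0// subr_ge0 ltW.
have r0 : 0 <= r by exact: expR_ge0.
have r1 : r <= 1 by rewrite expR_le1 oppr_le0.
have rD : 1 - r <= (b2 - b1) * l by rewrite lerBlDr -lerBlDl; exact: expR_ge1Dx.
have zE : zval lam l b1 = r%:C * zval lam l b2.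
  rewrite /zval mulrCA -rmorphM/= -expRD; congr (_ * (expR _)%:C); ring.
have small : C * (A1 + A2) * (1 + l) * e0 < 1.
  have hl : (1 + l) * e0 <= (1 + 2 / beta0) * expR (- (beta0 * l / 2)).
    have -> : e0 = expR (- (beta0 * l / 2)) * expR (- (beta0 * l / 2)).
      by rewrite -expRD; congr expR; field.
    rewrite mulrA ler_wpM2r ?expR_ge0// expRN ler_pdivrMr ?expR_gt0//.
    have := expR_ge1Dx (beta0 * l / 2) => he.
    rewrite (@le_trans _ _ ((1 + 2 / beta0) * (1 + beta0 * l / 2)))//.
      rewrite [leRHS](_ : _ = 1 + l + (2 / beta0 + beta0 * l / 2)); last first.
        by field; rewrite gt_eqF.
      by rewrite lerDl addr_ge0 ?divr_ge0 ?mulr_ge0 ?(ltW b00).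
    by rewrite ler_wpM2l// addr_ge0// divr_ge0// ltW.
  rewrite -mulrA; apply: le_lt_trans (ler_wpM2l _ hl) _.
    by rewrite mulr_ge0// addr_ge0.
  rewrite mulrA -/D; apply: mul_expRN_lt => //; rewrite divr1.
  have : beta0 / 2 * (2 / beta0 * D) <= beta0 / 2 * l.
    by rewrite ler_wpM2l// divr_ge0// ltW.
  rewrite (_ : beta0 / 2 * (2 / beta0 * D) = D); last by field; rewrite gt_eqF.
  by rewrite mulrAC.
move: err1 err2 slope H20.
move: (_ / Gamma _) (_ / Gamma _) (mittag_leffler _ _) (mittag_leffler _ _).
move=> h2 h1 E2 E1 err1 err2 slope h20 eqE; rewrite eqE in err1.
(* The first identity minus [r] times the second: the Mittag-Leffler terms cancel. *)
have main Y : 0 <= Y -> 2 * pi * (h1 - r * h2) <=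
    C * ((b2 - b1) * (A2 * (1 + l) * e0)) + (1 - r) * (C * (A1 * e0)) +
    (K1 + r * K2) * expR (- Y).
  move=> Y0; have := err1 Y Y0; have := err2 Y Y0.
  have := bound2 Y Y0; have := bound12 Y Y0; rewrite zE.
  move: (arcint _ _ _) (arcint _ _ _) (zval _ _ _) => F2 F1 z f12 f2 g2 g1.
  have eq1 : (2 * pi * (h1 - r * h2))%:C = (F1 - F2) + (1 - r)%:C * F2 -
      (F1 - (2 * pi)%:C * (r%:C * z * E2 + h1%:C)) +
      r%:C * (F2 - (2 * pi)%:C * (z * E2 + h2%:C)).
    rewrite [LHS]rmorphM/= realcB [(1 - r)%:C]realcB [(r * h2)%:C]rmorphM/= rmorph1.
    by ring.
  rewrite (le_trans (ler_norm _))// -normc_real eq1.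
  rewrite (le_trans (normc_triangle _ _))// [(K1 + _) * _]mulrDl addrA.
  rewrite lerD//; last first.
    by rewrite normcM normc_real_pos// -mulrA ler_wpM2l.
  rewrite (le_trans (normcB _ _))// lerD//.
  rewrite (le_trans (normc_triangle _ _))// lerD//.
  by rewrite normcM normc_real_pos ?subr_ge0// ler_wpM2l// subr_ge0.
have := le_of_expRN_error main; apply/negP; rewrite -ltNge.
have pi2 := pi_ge2 R.
have Dpos : 0 < b2 - b1 by rewrite subr_gt0.
have rh : r * h2 <= h2 by rewrite ler_piMl.
(* The slope 1/4 is compensated by [2 pi >= 4], and replacing [r h2] by [h2] uses [h2 >= 0]. *)
have lhs : b2 - b1 <= 2 * pi * (h1 - r * h2).
  have hh : (b2 - b1) / 4 <= h1 - r * h2 by lra.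
  rewrite (@le_trans _ _ (4 * (h1 - r * h2)))//; first by lra.
  by rewrite ler_wpM2r//; lra.
apply: lt_le_trans lhs.
rewrite (@le_lt_trans _ _ ((b2 - b1) * (C * (A1 + A2) * (1 + l) * e0)))//; last first.
  by rewrite gtr_pMr.
have e00 : 0 <= e0 by exact: expR_ge0.
have q1 : (1 - r) * (C * (A1 * e0)) <= (b2 - b1) * l * (C * (A1 * e0)).
  by apply: ler_wpM2r => //; apply: mulr_ge0 => //; exact: mulr_ge0.
have q2 : 0 <= (b2 - b1) * (C * (A1 * e0)).
  by apply: mulr_ge0; [exact: ltW|apply: mulr_ge0 => //; exact: mulr_ge0].
have q3 : 0 <= (b2 - b1) * (C * (A2 * e0)) by apply: mulr_ge0; [exact: ltW|apply: mulr_ge0 => //; exact: mulr_ge0].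
lra.
Qed.

End injectivity.

(** * From single eigenvalues to the vector of orders *)

(** Whatever the sign of the imaginary part, [|carg z|] is the arc cosine of [Re z / |z|], which
    exceeds [pi / 2] only when the quotient is negative. *)
Lemma carg_gt_pihalf (R : realType) (z : R[i]) : pi / 2 < `|carg z| -> Re z < 0.
Proof.
have q1 : -1 <= Re z / normc z <= 1.
  have [z0|z0] := eqVneq z 0; first by rewrite z0 mul0r; lra.
  have n0 : 0 < normc z by rewrite normc_gt0.
  have := Re_le_normc z.
  by rewrite ler_norml ler_pdivlMr// ler_pdivrMr// mulN1r mul1r.
have -> : `|carg z| = acos (Re z / normc z).
  by rewrite /carg; case: ifP => _; rewrite ?normrN ger0_norm// acos_ge0.
apply: contraTT; rewrite -!leNgt => z0.
have q0 : 0 <= Re z / normc z by rewrite divr_ge0 ?normc_ge0.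
have p2 : 0 <= (pi / 2 : R) <= pi.
  by have := pi_ge0 R; lra.
rewrite leNgt -ltr_cos ?in_itv/= ?acos_ge0 ?acos_lepi//.
by rewrite cos_pihalf acosK ?in_itv// -leNgt.
Qed.

Theorem theorem2p1 (R : realType) (n m : nat) (hn : (0 < n)%N) (hm : (0 < m)%N)
    (G : set 'rV[R]_n) (hG : open G)
    (p : R) (hp : 1 <= p)
    (A M : 'rV[R]_n -> 'M[R[i]]_m) (lambda : 'rV[R]_n -> 'rV[R[i]]_m)
    (hA : admissible_symbol M lambda G A)
    (phi phihat : 'I_m -> 'rV[R]_n -> R[i])
    (hphi : forall k, in_Psi G p (phi k) (phihat k))
    (beta0 : R) (hbeta0 : 0 < beta0 < 1)
    (xi0 : 'rV[R]_n) (hxi0 : G xi0)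
    (hK : \det (Kmx M phihat xi0) != 0) :
  exists T0 : R, 1 < T0 /\
    forall t0 : R, T0 < t0 ->
    forall d : 'cV[R[i]]_m,
      (forall l, mittag_leffler_range beta0 t0 (lambda xi0 0 l)
                   ((invmx (Kmx M phihat xi0) *m d) l 0)) ->
      exists! B : 'rV[R]_m,
        (forall l, beta0 <= B 0 l <= 1) /\
        (forall j, solution_hat M lambda phihat B j t0 xi0 = d j 0).
Proof.
have [_ _ _ _ argP] := hA; have /andP[b00 _] := hbeta0.
have inj l : exists T : R, 1 < T /\ forall t, T < t ->
    forall b1 b2, beta0 <= b1 <= 1 -> beta0 <= b2 <= 1 ->
    mittag_leffler b1 (lambda xi0 0 l * (t `^ b1)%:C) =
    mittag_leffler b2 (lambda xi0 0 l * (t `^ b2)%:C) -> b1 = b2.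
  have neg := carg_gt_pihalf (argP _ hxi0 l).
  by have [T T1 TP] := mittag_leffler_injective neg b00; exists T.
have [T TP] := choice inj.
(* One threshold for all eigenvalues: the [T l] are positive, so their sum dominates each of them,
   and the 2 secures [T0 > 1]. *)
exists (2 + \sum_l T l); split.
  have : 0 <= \sum_l T l.
    by apply: sumr_ge0 => l _; have [T1 _] := TP l; rewrite (le_trans ler01)// ltW.
  lra.
move=> t0 tT d dP.
have Tt l : T l < t0.
  apply: le_lt_trans tT; rewrite (bigD1 l)//= addrCA lerDl addr_ge0// sumr_ge0// => i _.
  by have [T1 _] := TP i; rewrite (le_trans ler01)// ltW.
set K := Kmx M phihat xi0 in dP hK.
have Ku : K \in unitmx by rewrite unitmxE unitfE.
pose E (B : 'rV[R]_m) : 'cV[R[i]]_m :=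
  \col_l mittag_leffler (B 0 l) (lambda xi0 0 l * (t0 `^ B 0 l)%:C).
have solE B j : solution_hat M lambda phihat B j t0 xi0 = (K *m E B) j 0.
  by rewrite /solution_hat mxE; apply: eq_bigr => l _; rewrite [E B l 0]mxE mulrC.
(* The ranges provide orders below 1; injectivity, which holds up to and including order 1, then
   excludes every other vector in the closed box. *)
have /choice[b bP] : forall l, exists b, beta0 <= b < 1 /\
    mittag_leffler b (lambda xi0 0 l * (t0 `^ b)%:C) = (invmx K *m d) l 0.
  by move=> l; have [b bI bE] := dP l; exists b; move: bI; rewrite /= in_itv.
pose B : 'rV[R]_m := \row_l b l.
have EB : E B = invmx K *m d.
  by apply/colP => l; rewrite [LHS]mxE [B 0 l]mxE (bP l).2.
have Bb l : beta0 <= B 0 l <= 1.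
  by have [+ _] := bP l; rewrite mxE => /andP[-> /ltW].
exists B; split.
  by split=> // j; rewrite solE EB mulKVmx.
move=> B' [B'b B'P]; apply/rowP => l.
have EB' : E B' = invmx K *m d.
  have -> : d = K *m E B' by apply/colP => j; rewrite -solE B'P.
  by rewrite mulKmx.
apply: (proj2 (TP l) t0 (Tt l) _ _ (Bb l) (B'b l)).
have := congr1 (fun v : 'cV_m => v l 0) (etrans EB (esym EB')).
by rewrite [LHS]mxE [RHS]mxE.
Qed.
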